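(* Let $n\geq 3$. Suppose that for some $h_{n-1}>0$ and $p_{n-1}>1$ the following holds: for every $\varepsilon>0$ there is a constant $C_{\varepsilon}$ such that $$\|(f)^*_{\delta}\|_{L^{p_{n-1}}(S^{n-2})} \leq C_\varepsilon\, \delta^{-h_{n-1}-\varepsilon}\,\|f\|_{L^{p_{n-1}}(\mathbb{R}^{n-1})}$$ for all $f \in L^1_{loc}(\mathbb{R}^{n-1})$ and all $0<\delta<1$. Let $$g_n(s)=\frac{h_{n-1}p_{n-1}+s p_{n-1}-s}{p_{n-1}}.$$ If $s\in[0,n]$, $A \subseteq \mathbb{R}^n$ is a bounded set with $\overline{\dim}_{\mathrm{B}} A \leq s$, and $K_A$ is an $A$-restricted Kakeya set in $\mathbb{R}^n$, then $$\dim_{\mathrm{H}} K_A \geq n-g_n(s).$$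
   Context: In $\mathbb{R}^d$, for $e \in S^{d-1}$ and $a\in\mathbb{R}^d$, let $I_e(a) = \{a + t e : -1/2 \leq t \leq 1/2\}$ be the unit line segment in direction $e$ with midpoint $a$, and for $\delta>0$ let $T_e^\delta(a)$ be the $\delta$-neighbourhood of $I_e(a)$ in $\mathbb{R}^d$. For $f\in L^1_{loc}(\mathbb{R}^d)$, the Kakeya maximal function $(f)^*_\delta : S^{d-1}\to\mathbb{R}$ is $$(f)^*_\delta(e)=\sup_{a\in\mathbb{R}^d}\frac{1}{|T_e^\delta(a)|}\int_{T_e^\delta(a)}|f(x)|\,dx$$ (the hypothesis uses $d=n-1$, and $S^{n-2}$ carries surface measure). Given a bounded set $A\subseteq\mathbb{R}^n$, a compact set $K_A\subseteq\mathbb{R}^n$ is an $A$-restricted Kakeya set if for every $e\in S^{n-1}$ there is a point $a_e\in A$ with $I_e(a_e)\subseteq K_A$. $\dim_{\mathrm{H}}$ is Hausdorff dimension, and $\overline{\dim}_{\mathrm{B}} A = \limsup_{\delta\to 0} \frac{\log N_\delta(A)}{-\log\delta}$ is the upper box-counting dimension, where $N_\delta(A)$ is the smallest number of sets of diameter at most $\delta$ needed to cover $A$. *)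

(* Defs.v *)
From HB Require Import structures.
From mathcomp Require Import all_boot all_order all_algebra.
From mathcomp Require Import all_classical all_reals all_analysis.
From mathcomp Require Import measurable_realfun.

Set Implicit Arguments.
Unset Strict Implicit.
Unset Printing Implicit Defensive.

Import Order.TTheory GRing.Theory Num.Theory.
Import numFieldNormedType.Exports.

Local Open Scope classical_set_scope.
Local Open Scope ring_scope.

Section euclidean.
Context {R : realType} {d : nat}.
Implicit Types (x e a : 'rV[R]_d) (U A : set 'rV[R]_d).

(* The library norm on ['rV[R]_d] is the sup norm: it induces the Euclidean
   topology, but lengths and diameters need the Euclidean norm. *)
Definition enorm x : R := Num.sqrt (\sum_(i < d) x ord0 i ^+ 2).

Definition diam U : \bar R :=
  ereal_sup [set (enorm (x - y))%:E | x in U & y in U].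

Definition unit_segment e a : set 'rV[R]_d :=
  [set a + t *: e | t in `[- 2^-1, 2^-1]].

Definition tube (delta : R) e a : set 'rV[R]_d :=
  [set x | exists2 y, unit_segment e a y & enorm (x - y) < delta].

Definition restricted_kakeya A (K : set 'rV[R]_d) : Prop :=
  compact K /\
  forall e : 'rV[R]_d, enorm e = 1 ->
    exists2 a, A a & unit_segment e a `<=` K.

End euclidean.

Definition measure_rV_display : measure_display -> measure_display.
Proof. exact. Qed.

Section measurable_rV.
Context {disp} {T : measurableType disp} (d : nat).

Let coors : 'I_d -> 'rV[T]_d -> T := fun i x => x ord0 i.

Let rV_set0 : g_sigma_preimage coors set0.
Proof. exact: sigma_algebra0. Qed.

Let rV_setC A : g_sigma_preimage coors A -> g_sigma_preimage coors (~` A).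
Proof. exact: sigma_algebraC. Qed.

Let rV_bigcup (F : _^nat) : (forall i, g_sigma_preimage coors (F i)) ->
  g_sigma_preimage coors (\bigcup_i (F i)).
Proof. exact: sigma_algebra_bigcup. Qed.

(* The product sigma-algebra, as the library does for [d.-tuple T]; over the
   reals it is the Borel sigma-algebra. *)
HB.instance Definition _ := @isMeasurable.Build (measure_rV_display disp)
  'rV[T]_d (g_sigma_preimage coors) rV_set0 rV_setC rV_bigcup.

End measurable_rV.

Lemma measurable_coord disp (T : measurableType disp) d (i : 'I_d) :
  measurable_fun [set: 'rV[T]_d] (fun x => x ord0 i).
Proof.
move=> _ Y mY; rewrite setTI; apply: sub_sigma_algebra => /=.
rewrite -bigcup_seq/=; exists i => /=; first by rewrite mem_index_enum.
by exists Y => //; rewrite setTI.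
Qed.

Lemma measurable_fun_rV disp1 disp2 (T1 : measurableType disp1)
    (T2 : measurableType disp2) d (f : T1 -> 'rV[T2]_d) :
  (forall i, measurable_fun [set: T1] (fun x => f x ord0 i)) ->
  measurable_fun [set: T1] f.
Proof.
move=> mf _ Y mY; rewrite setTI.
pose G : set (set 'rV[T2]_d) := [set A | measurable (f @^-1` A)].
suff : G Y by [].
have sG : sigma_algebra setT G.
  split => [|A GA|F GF]; rewrite /G /=.
  - by rewrite preimage_set0; exact: (@measurable0 _ T1).
  - by rewrite setTD preimage_setC; exact: (@measurableC _ T1).
  - by rewrite preimage_bigcup; apply: bigcup_measurable => k _; exact: GF.
apply: (smallest_sub sG _ mY) => A.
rewrite -bigcup_seq => -[i _ [B mB <-]] /=.
by have := mf i measurableT B mB; rewrite /G /= !setTI.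
Qed.

Section lebesgue_rV.
Context {R : realType}.

Definition cons_rV {d} (xv : R * 'rV[R]_d) : 'rV[R]_d.+1 :=
  row_mx (xv.1%:M : 'M[R]_1) xv.2.

Let uncons_rV {d} (u : 'rV[R]_d.+1) : R * 'rV[R]_d :=
  (u ord0 ord0, \row_i u ord0 (lift ord0 i)).

Let cons_rV0 d (xv : R * 'rV[R]_d) : cons_rV xv ord0 ord0 = xv.1.
Proof.
have -> : ord0 = lshift d ord0 :> 'I_(1 + d) by exact: val_inj.
by rewrite [LHS]row_mxEl mxE eqxx.
Qed.

Let cons_rVS d (xv : R * 'rV[R]_d) i :
  cons_rV xv ord0 (lift ord0 i) = xv.2 ord0 i.
Proof.
have -> : lift ord0 i = rshift 1 i :> 'I_(1 + d) by exact: val_inj.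
exact: row_mxEr.
Qed.

Let cons_rVK d : cancel (@cons_rV d) uncons_rV.
Proof.
move=> [x v]; rewrite /uncons_rV cons_rV0; congr pair.
by apply/rowP => i; rewrite mxE cons_rVS.
Qed.

Let uncons_rVK d : cancel uncons_rV (@cons_rV d).
Proof.
move=> u; apply/rowP => i.
by case: (unliftP ord0 i) => [j|] ->; rewrite ?cons_rV0 ?cons_rVS ?mxE.
Qed.

Let measurable_cons_rV d : measurable_fun setT (@cons_rV d).
Proof.
apply: measurable_fun_rV => i.
case: (unliftP ord0 i) => [j ->|->].
  under eq_fun do rewrite cons_rVS.
  exact: (measurableT_comp (measurable_coord j) measurable_snd).
under eq_fun do rewrite cons_rV0.
exact: measurable_fst.
Qed.

Let measurable_uncons_rV d :
  measurable_fun setT (uncons_rV : 'rV[R]_d.+1 -> R * 'rV[R]_d).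
Proof.
apply/measurable_fun_pairP; split; first exact: measurable_coord.
apply: measurable_fun_rV => i.
under eq_fun do rewrite /= mxE.
exact: measurable_coord.
Qed.

Section step.
Context {d : nat} (mu : {sigma_finite_measure set 'rV[R]_d -> \bar R}).

Definition lebesgue_rV_step : set 'rV[R]_d.+1 -> \bar R :=
  pushforward (lebesgue_measure \x mu)%E cons_rV.

Let step0 : lebesgue_rV_step set0 = 0%E.
Proof. by rewrite /lebesgue_rV_step /pushforward preimage_set0 measure0. Qed.

Let step_ge0 A : (0 <= lebesgue_rV_step A)%E.
Proof. by rewrite /lebesgue_rV_step /pushforward; apply: measure_ge0. Qed.

Let step_sigma_additive : semi_sigma_additive lebesgue_rV_step.
Proof.
move=> F mF tF mUF.
rewrite /lebesgue_rV_step /pushforward preimage_bigcup.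
have mcons A : measurable A -> measurable (@cons_rV d @^-1` A).
  by move=> mA; rewrite -[X in measurable X]setTI; exact: measurable_cons_rV.
apply: measure_semi_sigma_additive => [n||]; first exact: mcons.
  apply/trivIsetP => /= i j _ _ ij; rewrite -preimage_setI.
  by move/trivIsetP : tF => /(_ _ _ _ _ ij) ->//; rewrite preimage_set0.
by rewrite -preimage_bigcup; exact: mcons.
Qed.

HB.instance Definition _ := isMeasure.Build _ _ _ lebesgue_rV_step
  step0 step_ge0 step_sigma_additive.

Let step_sigma_finite : sigma_finite setT lebesgue_rV_step.
Proof.
have /sigma_finiteP[F [TF ndF Foo]] :=
  sigma_finiteT (@lebesgue_measure R : {sigma_finite_measure set _ -> \bar R}).
have /sigma_finiteP[G [TG ndG Goo]] := sigma_finiteT mu.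
exists (fun n => uncons_rV @^-1` (F n `*` G n)).
  rewrite -preimage_bigcup -[LHS](preimage_setT uncons_rV); congr preimage.
  rewrite -setXTT TF TG predeqE => -[x y]; split; last first.
    by move=> [n _ []/= ? ?]; split; exists n.
  move=> [/= [n _ Fnx] [k _ Gky]]; exists (maxn n k) => //; split.
    by move: x Fnx; exact/subsetPset/ndF/leq_maxl.
  by move: y Gky; exact/subsetPset/ndG/leq_maxr.
move=> n; have [mF Fy] := Foo n; have [mG Gy] := Goo n; split.
  rewrite -[X in measurable X]setTI; apply: measurable_uncons_rV => //.
  exact: measurableX.
rewrite /lebesgue_rV_step /pushforward -comp_preimage.
rewrite (_ : _ \o _ = id); last by apply/funext => x /=; rewrite cons_rVK.
by rewrite product_measure1E// lte_mul_pinfty// ge0_fin_numE.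
Qed.

HB.instance Definition _ := Measure_isSigmaFinite.Build _ _ _ lebesgue_rV_step
  step_sigma_finite.

End step.

Fixpoint lebesgue_rV (d : nat) : {sigma_finite_measure set 'rV[R]_d -> \bar R} :=
  if d is d'.+1 then lebesgue_rV_step (lebesgue_rV d') else \d_(0 : 'rV[R]_0).

End lebesgue_rV.

Section surface_measure.
Context {R : realType} {d : nat}.
Implicit Types (x : 'rV[R]_d) (E : set 'rV[R]_d).

Definition cone E : set 'rV[R]_d :=
  [set x | 0 < enorm x <= 1 /\ E ((enorm x)^-1 *: x)].

(* Polar coordinates: the cone over [E] has Lebesgue measure
   [\int_0^1 r ^ (d - 1) sigma(E) dr = sigma(E) / d].  The measure lives on the
   whole space but is carried by the unit sphere. *)
Definition surface_measure E : \bar R := (d%:R%:E * lebesgue_rV d (cone E))%E.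

Let normalize x : 'rV[R]_d := (enorm x)^-1 *: x.

Let measurable_enorm : measurable_fun setT (@enorm R d).
Proof.
apply: (@measurableT_comp _ _ _ _ _ _ (@Num.sqrt R)).
  by apply: continuous_measurable_fun; exact: sqrt_continuous.
apply: measurable_sum => i; apply: measurable_funX.
exact: measurable_coord.
Qed.

Let measurable_normalize : measurable_fun setT normalize.
Proof.
apply: measurable_fun_rV => i.
under eq_fun do rewrite mxE -powR_inv1 ?sqrtr_ge0//.
apply: measurable_funM; last exact: measurable_coord.
exact: (measurableT_comp (measurable_powR (-1)) measurable_enorm).
Qed.

Let measurable_cone E : measurable E -> measurable (cone E).
Proof.
move=> mE.
have -> : cone E = enorm @^-1` `]0, 1] `&` normalize @^-1` E.
  by apply/seteqP; split => x /=; rewrite in_itv.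
apply: measurableI.
  by rewrite -[X in measurable X]setTI; exact: measurable_enorm.
by rewrite -[X in measurable X]setTI; exact: measurable_normalize.
Qed.

Let surface0 : surface_measure set0 = 0%E.
Proof.
rewrite /surface_measure (_ : cone set0 = set0) ?measure0 ?mule0//.
by apply/seteqP; split => x // [].
Qed.

Let surface_ge0 E : (0 <= surface_measure E)%E.
Proof. by rewrite mule_ge0. Qed.

Let surface_sigma_additive : semi_sigma_additive surface_measure.
Proof.
move=> F mF tF mUF.
have coneU : cone (\bigcup_n F n) = \bigcup_n cone (F n).
  apply/seteqP; split => [x [x1 [n _ Fx]]|x [n _ [x1 Fx]]].
    by exists n.
  by split => //; exists n.
rewrite /surface_measure coneU.
apply: (@measure_semi_sigma_additive _ _ _
  (mscale (NngNum (ler0n R d)) (lebesgue_rV d)) (cone \o F)).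
- by move=> n; exact: measurable_cone.
- apply/trivIsetP => i j _ _ ij; apply/seteqP; split => // x [[_ Fix] [_ Fjx]].
  move/trivIsetP : tF => /(_ _ _ Logic.I Logic.I ij) F0.
  by have : (F i `&` F j) (normalize x) by []; rewrite F0.
- by rewrite -coneU; exact: measurable_cone.
Qed.

HB.instance Definition _ := isMeasure.Build _ _ _ surface_measure
  surface0 surface_ge0 surface_sigma_additive.

End surface_measure.

Section kakeya_maximal.
Context {R : realType} {d : nat}.
Implicit Types (f : 'rV[R]_d -> R).
Local Open Scope ereal_scope.

Definition locally_integrable_rV f : Prop :=
  measurable_fun setT f /\
  forall K, compact K -> \int[lebesgue_rV d]_(x in K) `|f x|%:E < +oo.

Definition kakeya_maximal (delta : R) f (e : 'rV[R]_d) : \bar R :=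
  ereal_sup [set (lebesgue_rV d (tube delta e a))^-1 *
    \int[lebesgue_rV d]_(x in tube delta e a) `|f x|%:E | a in [set: 'rV[R]_d]].

(* The supremum may be infinite, and so may [f]'s norm: the inequality is
   between extended reals. *)
Definition kakeya_maximal_bound (h p : R) : Prop :=
  forall eps : R, (0 < eps)%R -> exists C : R,
  forall f, locally_integrable_rV f ->
  forall delta : R, (0 < delta < 1)%R ->
  'N[surface_measure]_p%:E[kakeya_maximal delta f] <=
    (C * delta `^ (- h - eps))%:E * 'N[lebesgue_rV d]_p%:E[EFin \o f].

End kakeya_maximal.
Arguments kakeya_maximal_bound {R} d h p.

Section dimensions.
Context {R : realType} {d : nat}.
Implicit Types (A U : set 'rV[R]_d) (s delta : R).
Local Open Scope ereal_scope.

(* [0 `^ 0 = 1], so a point counts for 1 in the 0-dimensional measure; the empty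
   set must still count for 0. *)
Definition diam_pow s U : \bar R :=
  if U == set0 then 0 else diam U `^ s.

Definition hausdorff_content s delta A : \bar R :=
  ereal_inf [set \sum_(0 <= k <oo) diam_pow s (U k) | U in
    [set U : nat -> set 'rV[R]_d |
      A `<=` \bigcup_k U k /\ forall k, diam (U k) <= delta%:E]].

Definition hausdorff_measure s A : \bar R :=
  ereal_sup [set hausdorff_content s delta A | delta in `]0%R, +oo[].

Definition hausdorff_dim A : \bar R :=
  ereal_inf [set s%:E | s in [set s | (0 <= s)%R /\ hausdorff_measure s A = 0]].

Definition covering_number delta A : \bar R :=
  ereal_inf [set k%:R%:E | k in [set k : nat |
    exists U : 'I_k -> set 'rV[R]_d,
      A `<=` \bigcup_i U i /\ forall i, diam (U i) <= delta%:E]].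

Definition upper_box_dim A : \bar R :=
  limf_esup (fun delta => lne (covering_number delta A) * ((- ln delta)^-1)%:E)
    0%R^'+.

End dimensions.

Definition g_exponent {R : realType} (h p s : R) : R := (h * p + s * p - s) / p.

(* Main.v *)
(**
  Cover [K] by dyadic cells and pigeonhole a scale [M = 2 ^ j] at which many
  directions [(1, q / M)] have a tube, based at a point of [A], that is well
  filled by the cells of that scale.  By Cauchy-Schwarz the number of cells is
  bounded below as soon as the pairs of intersecting tubes are bounded above.

  To count these pairs, group the tubes by the [N <= M ^ (s + eps)] sets of a
  cover of [A] that contain their base points, fix one such base point [a] and
  a dyadic distance [L / M] between the two directions, measured in a
  coordinate [i], and fix moreover the value [t] of that coordinate for the
  first direction.  The projection from [a] onto a hyperplane parallel to
  [x_i = t x_0] turns the tubes based at [a] into points of [R ^ (n - 1)], and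
  a tube whose direction lies in that hyperplane into a tube of
  [R ^ (n - 1)] with the same direction.  Hence the maximal inequality in
  dimension [n - 1] bounds the incidences by a multiple of [L ^ (h + eps)]
  times the [1 / p]-th power of the measure of the set of points, and the power
  mean inequality over the [N] base points yields the factor
  [N ^ (1 - 1 / p)].
*)

(* The exponents work as follows. At scale [M] there are about [M ^ (n - 1)] tubes with about [M]
   cells each, so Cauchy-Schwarz bounds [M ^ (2 n)] by the number of cells times the number of
   triples (tube, tube, common cell). Two tubes at distance [L / M] share at most about [M / L]
   cells, and there are at most about [M ^ (n - 1) L ^ (1 + h) N ^ (1 - 1 / p)] such pairs: for one
   box of directions of side [L] and one [t] the incidences number
   [L ^ (n - 1 + h) N ^ (1 - 1 / p)], and there are [(M / L) ^ (n - 1)] boxes and [L] values of [t]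
   in each. The triples are then dominated by [L = M], which leaves [M ^ (n - h - s (1 - 1 / p))]
   cells. The finest scale of the cover of [K] is out of control, so a pigeonhole that loses the
   number of scales would be useless. Geometric weights [theta ^ j] with [theta = 2 ^ (- eps)] lose
   only [M ^ eps] at the scale that is selected. *)
Require Import Defs.
From mathcomp Require Import all_boot all_order all_algebra.
From mathcomp Require Import all_classical all_reals all_analysis.
From mathcomp Require Import measurable_realfun ring lra zify.

Import Order.TTheory GRing.Theory Num.Theory.
Import numFieldNormedType.Exports.

Local Open Scope classical_set_scope.
Local Open Scope ring_scope.

(** * Volumes of sheared boxes *)

Section integral.
Local Open Scope ereal_scope.

(* The integral of a nonnegative function, measurable or not, is a supremum over
   the simple functions below it. *)
Lemma ge0_le_integral_nomeas (disp : measure_display) (T : measurableType disp)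
    (R : realType) (mu : {measure set T -> \bar R}) (D : set T)
    (f1 f2 : T -> \bar R) :
  (forall x, D x -> 0 <= f1 x) -> (forall x, D x -> f1 x <= f2 x) ->
  \int[mu]_(x in D) f1 x <= \int[mu]_(x in D) f2 x.
Proof.
move=> f10 f12; rewrite !ge0_integralE//; last first.
  by move=> x Dx; apply: le_trans (f12 _ Dx); exact: f10.
apply: le_ereal_sup => _ [h /= hf <-]; exists h => // x.
apply: le_trans (hf x) _; rewrite /patch; case: ifP => // /set_mem.
exact: f12.
Qed.

Lemma ge0_subset_integral_nomeas (disp : measure_display)
    (T : measurableType disp)
    (R : realType) (mu : {measure set T -> \bar R}) (D E : set T)
    (f : T -> \bar R) :
  (forall x, 0 <= f x) -> D `<=` E ->
  \int[mu]_(x in D) f x <= \int[mu]_(x in E) f x.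
Proof.
move=> f0 DE; rewrite [leLHS]integral_mkcond [leRHS]integral_mkcond.
apply: ge0_le_integral_nomeas => x _; rewrite /patch; case: ifPn => //.
by move=> /set_mem /DE /mem_set ->.
by move=> _; case: ifP.
Qed.

End integral.

Section lebesgue_rV.
Context {R : realType}.

Lemma cons_rV0E {d} (x : R) (v : 'rV[R]_d) : cons_rV (x, v) ord0 ord0 = x.
Proof.
have -> : ord0 = lshift d ord0 :> 'I_(1 + d) by exact: val_inj.
by rewrite [LHS]row_mxEl mxE eqxx.
Qed.

Lemma cons_rVSE {d} (x : R) (v : 'rV[R]_d) i :
  cons_rV (x, v) ord0 (lift ord0 i) = v ord0 i.
Proof.
have -> : lift ord0 i = rshift 1 i :> 'I_(1 + d) by exact: val_inj.
exact: row_mxEr.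
Qed.

Lemma lebesgue_rVS d (A : set 'rV[R]_d.+1) :
  lebesgue_rV d.+1 A = (\int[lebesgue_measure]_x
    lebesgue_rV d [set v | A (cons_rV (x, v))])%E.
Proof.
rewrite /= /lebesgue_rV_step /pushforward /product_measure1.
apply: eq_integral => x _ /=; congr (lebesgue_rV d _).
by apply/seteqP; split => v; rewrite /xsection /= inE.
Qed.

(** Stated for arbitrary sets so that it applies directly to tubes and cones: the measure is an
    iterated integral of slices, and monotonicity passes through each integral by
    [ge0_le_integral_nomeas]. *)
Lemma le_lebesgue_rV d (A B : set 'rV[R]_d) :
  A `<=` B -> (lebesgue_rV d A <= lebesgue_rV d B)%E.
Proof.
elim: d A B => [|d IH] A B AB.
  rewrite /= /dirac !indicE lee_fin ler_nat.
  by case: (boolP (0 \in A)) => [/set_mem/AB/mem_set->|].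
rewrite !lebesgue_rVS; apply: ge0_le_integral_nomeas => x _ //.
by apply: IH => v; exact: AB.
Qed.

Definition cube {d} (c : 'I_d -> R) (w : R) : set 'rV[R]_d :=
  [set x | forall k, `|x ord0 k - c k| <= w].

(** One shape serves to bound cones over caps from below and tubes from above. Its slices at a fixed
    first coordinate are cubes, so the shear does not affect the volume. *)
Definition sheared_box {d} (lo hi : R) (q y : 'I_d -> R) (w : R) :
    set 'rV[R]_d.+1 :=
  [set x | lo <= x ord0 ord0 <= hi /\ forall k,
    `|x ord0 (lift ord0 k) - (q k + x ord0 ord0 * y k)| <= w].

Lemma measurable_cube d c w : measurable (@cube d c w).
Proof.
have -> : cube c w = \bigcap_(k in [set: 'I_d])
    ((fun x : 'rV[R]_d => x ord0 k) @^-1` `[c k - w, c k + w]).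
  apply/seteqP; split => x /=.
    by move=> H k _ /=; rewrite in_itv/= -ler_distl.
  by move=> H k; have /= := H k Logic.I; rewrite in_itv/= -ler_distl.
apply: fin_bigcap_measurable => // k _; rewrite -[X in measurable X]setTI.
by apply: measurable_coord => //; exact: measurable_itv.
Qed.

(** The volume of cubes is a hypothesis because [lebesgue_cube] is itself proved by induction
    through this step, a cube being a sheared box of slope 0. *)
Lemma lebesgue_sheared_box_step d lo hi q y w v : lo <= hi -> (0 <= v) ->
  (forall c, lebesgue_rV d (cube c w) = v%:E) ->
  lebesgue_rV d.+1 (@sheared_box d lo hi q y w) = ((hi - lo) * v)%:E.
Proof.
move=> lohi v0 cubeE; rewrite lebesgue_rVS.
transitivity (\int[lebesgue_measure]_x (v%:E * (\1_`[lo, hi] x)%:E))%E.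
  apply: eq_integral => x _; rewrite indicE; case: (boolP (x \in _)) =>
    [/set_mem|/negP].
    rewrite /= in_itv/= => xi; rewrite mule1 -(cubeE (fun k => q k + x * y k)).
    congr (lebesgue_rV d _); apply/seteqP; split => z /=.
      by rewrite /sheared_box /= cons_rV0E => -[_ H] k; have := H k;
        rewrite cons_rVSE.
    by move=> H; rewrite /sheared_box /= cons_rV0E; split => // k;
      rewrite cons_rVSE.
  rewrite inE /= in_itv/= => xi; rewrite mule0 (_ : mkset _ = set0) ?measure0//.
  by apply/seteqP; split => z //; rewrite /sheared_box /= cons_rV0E => -[].
rewrite ge0_integralZl_EFin//; last first.
  by apply/measurable_EFinP; apply: measurable_indic.
rewrite integral_indic// setIT mulrC EFinM; congr (_ * _)%E.
have := @lebesgue_measure_itv R `[lo, hi]; rewrite /= lte_fin => ->.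
case: ltP => [_|hilo]; first by rewrite EFinB.
by rewrite (_ : hi = lo) ?subrr//; apply/eqP; rewrite eq_le hilo.
Qed.

Lemma lebesgue_cube d (c : 'I_d -> R) w : 0 <= w ->
  lebesgue_rV d (cube c w) = ((2 * w) ^+ d)%:E.
Proof.
move=> w0; elim: d c => [|d IH] c.
  rewrite /= /dirac indicE mem_set ?expr0//.
  by move=> [].
have -> : cube c w = @sheared_box d (c ord0 - w) (c ord0 + w)
    (fun k => c (lift ord0 k)) (fun=> 0) w.
  apply/seteqP; split => x; rewrite /sheared_box/cube/=.
    move=> H; split; first by rewrite -ler_distl.
    by move=> k; rewrite mulr0 addr0.
  rewrite -ler_distl => -[H0 H] k.
  case: (unliftP ord0 k) => [j|] -> //.
  by have := H j; rewrite mulr0 addr0.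
rewrite (@lebesgue_sheared_box_step d _ _ _ _ _ ((2 * w) ^+ d)) ?exprn_ge0//;
  last 2 first.
  by lra.
  by rewrite mulr_ge0.
by congr (_%:E); rewrite exprS; congr (_ * _); ring.
Qed.

Lemma lebesgue_sheared_box d lo hi q y w : lo <= hi -> 0 <= w ->
  lebesgue_rV d.+1 (@sheared_box d lo hi q y w) = ((hi - lo) * (2 * w) ^+ d)%:E.
Proof.
move=> lohi w0; apply: lebesgue_sheared_box_step => //.
  by rewrite exprn_ge0// mulr_ge0.
by move=> c; exact: lebesgue_cube.
Qed.

End lebesgue_rV.

(** * The power mean inequality *)

Section power_mean.
Context {R : realType}.

(** Young's inequality for the product of [x i / S] and 1, where [S] is the power mean: the [p]-th
    powers of [x i / S] sum to [#|A|], so the bounds add up to [#|A|]. *)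
Lemma sum_le_power_mean (T : finType) (A : {set T}) (x : T -> R) (p : R) :
  1 < p -> (forall i, 0 <= x i) ->
  \sum_(i in A) x i <=
    #|A|%:R * ((\sum_(i in A) x i `^ p) / #|A|%:R) `^ p^-1.
Proof.
move=> p1 x0; have p0 : 0 < p by lra.
have [->|/set0Pn[a aA]] := eqVneq A finset.set0.
  by rewrite !big_set0 mulr_ge0// powR_ge0.
have A0 : 0 < #|A|%:R :> R by rewrite ltr0n; apply/card_gt0P; exists a.
set S := _ `^ p^-1.
have Sp0 : 0 <= (\sum_(i in A) x i `^ p) / #|A|%:R.
  by apply: divr_ge0; [apply: sumr_ge0 => i _; exact: powR_ge0|exact: ltW].
have Spp : S `^ p = (\sum_(i in A) x i `^ p) / #|A|%:R.
  by rewrite /S -powRrM mulVf ?gt_eqF// powRr1.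
have [S0|S0] := eqVneq S 0.
  move: Spp; rewrite S0 powR0 ?gt_eqF// mulr0 => /esym/eqP.
  rewrite mulf_eq0 invr_eq0 (gt_eqF A0) orbF psumr_eq0; last first.
    by move=> i _; rewrite powR_ge0.
  move=> /allP xi0; rewrite big1// => i iA.
  have := xi0 i (mem_index_enum _); rewrite iA/= => /eqP.
  exact: powR_eq0_eq0.
have {}S0 : 0 < S by rewrite lt0r S0 powR_ge0.
have young i : x i / S <= (x i / S) `^ p / p + (1 - p^-1).
  have q0 : 0 < p / (p - 1) by rewrite divr_gt0//; lra.
  have := @conjugate_powR R (x i / S) 1 p (p / (p - 1)).
  rewrite mulr1 powR1 invf_div mul1r => h.
  have -> : 1 - p^-1 = (p - 1) / p by field; lra.
  apply: h => //; first by rewrite divr_ge0// ltW.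
  by field; lra.
have : \sum_(i in A) (x i / S) <= #|A|%:R.
  apply: le_trans (ler_sum _ (fun i _ => young i)) _.
  rewrite big_split/= -mulr_suml sumr_const.
  under eq_bigr do rewrite powRM ?invr_ge0 ?(ltW S0)//.
  rewrite -!mulr_suml -[S^-1]powR_inv1 ?(ltW S0)// -powRrM mulN1r powRN Spp.
  set u := \sum_(i in A) _; have u0 : u != 0.
    by apply: contraTneq S0 => u0; rewrite /S -/u u0 mul0r powR0 ?ltxx//
      invr_eq0 gt_eqF.
  rewrite invf_div [u * _]mulrCA mulfV// mulr1 -[(1 - p^-1) *+ _]mulr_natr.
  have -> : #|A|%:R / p + (1 - p^-1) * #|A|%:R = #|A|%:R by field; lra.
  by [].
by rewrite -mulr_suml ler_pdivrMr.
Qed.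

Lemma sum_le_power_mean_card (T : finType) (A : {set T}) (x : T -> R) (p N :
  R) :
  1 < p -> (forall i, 0 <= x i) -> #|A|%:R <= N ->
  \sum_(i in A) x i <= N * ((\sum_(i in A) x i `^ p) / N) `^ p^-1.
Proof.
move=> p1 x0 AN; have [A0|] := posnP #|A|.
  rewrite big1 ?mulr_ge0 ?powR_ge0//; first by rewrite (le_trans _ AN).
  by move=> i; rewrite (cards0_eq A0) inE.
move=> A0; have A0r : 0 < #|A|%:R :> R by rewrite ltr0n.
have N0 : 0 < N by apply: lt_le_trans AN.
apply: le_trans (sum_le_power_mean _ A _ _ p1 x0) _.
set S := \sum_(i in A) _; have S0 : 0 <= S by apply: sumr_ge0 => i _; exact:
  powR_ge0.
have E (n : R) : 0 < n -> n * (S / n) `^ p^-1 = n `^ (1 - p^-1) * S `^ p^-1.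
  move=> n0; rewrite powRM ?invr_ge0 ?(ltW n0)// powRD; last first.
    by rewrite (gt_eqF n0) implybT.
  by rewrite powRr1 ?(ltW n0)// powRN -[n^-1]powR_inv1 ?(ltW n0)// powRAC
    powR_inv1 ?powR_ge0//; ring.
rewrite !E// ler_wpM2r ?powR_ge0// ge0_ler_powR ?nnegrE ?(ltW A0r) ?(ltW N0)//.
by rewrite subr_ge0 invf_le1 ?ltW// (lt_trans ltr01).
Qed.

End power_mean.

(** * Caps of directions and tubes *)

Section enorm.
Context {R : realType} {d : nat}.
Implicit Type x : 'rV[R]_d.

Lemma coord_le_enorm x i : `|x ord0 i| <= enorm x.
Proof.
rewrite /enorm -sqrtr_sqr ler_wsqrtr// (bigD1 i)//= lerDl.
by apply: sumr_ge0 => j _; exact: sqr_ge0.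
Qed.

Lemma enorm_le x (B : R) :
  (forall i, `|x ord0 i| <= B) -> enorm x <= d%:R * B.
Proof.
move=> xB; have [d0|d0] := posnP d.
  rewrite /enorm big1 ?sqrtr0 ?d0 ?mul0r// => i.
  by exfalso; move: (ltn_ord i); rewrite [X in (_ < X)%N]d0.
have B0 : 0 <= B by apply: le_trans (xB (Ordinal d0)).
rewrite /enorm -[leRHS]ger0_norm ?mulr_ge0// -sqrtr_sqr ler_wsqrtr//.
apply: (@le_trans _ _ (\sum_(i < d) B ^+ 2)).
  by apply: ler_sum => i _; rewrite -[x _ _ ^+ 2]real_normK ?num_real// lerXn2r
    ?nnegrE.
rewrite sumr_const card_ord -[leLHS]mulr_natl exprMn ler_wpM2r ?sqr_ge0//.
by rewrite -natrX ler_nat; nia.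
Qed.

End enorm.

Section caps.
Context {R : realType} {d : nat}.
Implicit Types (y q : 'I_d -> R) (e a c : 'rV[R]_d.+1) (w r : R).

Let kap : R := (3 * d.+1%:R)^-1.

Let kap_gt0 : 0 < kap. Proof. by rewrite invr_gt0 mulr_gt0. Qed.

(* Directions are parametrized by their slopes with respect to the first
   coordinate.  There is no condition [enorm e = 1], because [surface_measure]
   only sees the unit sphere. *)
Definition cap y w : set 'rV[R]_d.+1 :=
  [set e | (3 * d.+1%:R)^-1 <= e ord0 ord0 <= 1 /\ forall k,
     `|e ord0 (lift ord0 k) - e ord0 ord0 * y k| < e ord0 ord0 * w].

Lemma measurable_cap y w : measurable (cap y w).
Proof.
have -> : cap y w =
    (fun e => e ord0 ord0) @^-1` `[kap, 1] `&`
    \bigcap_(k in [set: 'I_d])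
      ((fun e : 'rV[R]_d.+1 =>
        `|e ord0 (lift ord0 k) - e ord0 ord0 * y k| - e ord0 ord0 * w) @^-1`
          `]-oo, 0[).
  apply/seteqP; split => e /=.
    move=> [H1 H2]; split; first by rewrite in_itv.
    by move=> k _ /=; rewrite in_itv/= subr_lt0.
  rewrite in_itv/= => -[H1 H2]; split => // k.
  by have := H2 k Logic.I; rewrite /= in_itv/= subr_lt0.
have m0 (i : 'I_d.+1) := @measurable_coord _ (measurableTypeR R) _ i.
apply: measurableI.
  by rewrite -[X in measurable X]setTI; apply: m0 => //; exact: measurable_itv.
apply: fin_bigcap_measurable => // k _; rewrite -[X in measurable X]setTI.
have mf : measurable_fun [set: 'rV[R]_d.+1] (fun e : 'rV[R]_d.+1 =>
        `|e ord0 (lift ord0 k) - e ord0 ord0 * y k| - e ord0 ord0 * w).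
  apply: measurable_funB; last by apply: measurable_funM => //; exact: m0.
  apply: (measurableT_comp (@normr_measurable R setT)).
  by apply: measurable_funB; [exact: m0|apply: measurable_funM => //; exact:
    m0].
by apply: mf => //; exact: measurable_itv.
Qed.

(** The cone contains the sheared box of slopes [y] over first coordinates [t] in [[kap, 2 * kap]].
    Entries there are at most [3 / 2 * t], so the norm is at most [d.+1%:R * 3 * kap], and [kap] is
    chosen to make this 1. *)
Lemma surface_cap_ge y w : 0 < w <= 2^-1 -> (forall k, `|y k| <= 1) ->
  (((3 * d.+1%:R)^-1 * ((3 * d.+1%:R)^-1 * w) ^+ d)%:E <=
    surface_measure (cap y w))%E.
Proof.
move=> /andP[w0 w1] y1; rewrite -/kap; have k0 := kap_gt0.
apply: (@le_trans _ _ (lebesgue_rV d.+1 (cone (cap y w)))); last first.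
  rewrite /surface_measure -[leLHS]mul1e lee_wpmul2r//.
  by rewrite lee_fin ler1n.
have := @lebesgue_sheared_box R d kap (2 * kap) (fun=> 0) y (kap * w / 2).
have -> : 2 * (kap * w / 2) = kap * w by field.
have -> : 2 * kap - kap = kap by ring.
move=> <-; [|by lra|by rewrite !mulr_ge0 ?invr_ge0// ltW].
apply: le_lebesgue_rV => x [/andP[x1 x2] xk].
set t := x ord0 ord0 in x1 x2 xk *.
have t0 : 0 < t by lra.
have xk' k : `|x ord0 (lift ord0 k) - t * y k| <= t * w / 2.
  have := xk k; rewrite add0r => /le_trans; apply.
  by rewrite ler_wpM2r ?invr_ge0// ler_wpM2r// ltW.
have ex : enorm x <= d.+1%:R * (3 / 2 * t).
  apply: enorm_le => i; case: (unliftP ord0 i) => [k|] ->; last first.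
    by rewrite -/t gtr0_norm//; lra.
  have h1 : `|t * y k| <= t by rewrite normrM gtr0_norm// ler_piMr// ltW.
  have h2 : t * w <= t * 2^-1 by rewrite ler_wpM2l// ltW.
  have := xk' k; move: h1; rewrite !ler_norml.
  by move=> /andP[? ?] /andP[? ?]; apply/andP; split; lra.
have ex0 : 0 < enorm x by apply: lt_le_trans (coord_le_enorm x ord0);
  rewrite gtr0_norm.
have dk : d.+1%:R * (3 * kap) = 1.
  by rewrite mulrCA mulrA mulfV// mulf_neq0// pnatr_eq0.
have ex1 : enorm x <= 1.
  apply: le_trans ex _; rewrite -[leRHS]dk ler_wpM2l//; lra.
split; first by rewrite ex0.
have kt : kap * enorm x <= t.
  apply: (@le_trans _ _ (kap * (d.+1%:R * (3 / 2 * t)))).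
    by rewrite ler_wpM2l// ltW.
  have -> : kap * (d.+1%:R * (3 / 2 * t)) = (d.+1%:R * (3 * kap)) * (t / 2) by
    field.
  by rewrite dk; lra.
split.
  rewrite mxE -/kap [(enorm x)^-1 * _]mulrC ler_pdivlMr// ler_pdivrMr// kt
    mul1r.
  by apply: le_trans (ler_norm _) (coord_le_enorm x ord0).
move=> k; rewrite !mxE -mulrA -mulrBr normrM gtr0_norm ?invr_gt0// -mulrA.
rewrite ltr_pM2l ?invr_gt0// (le_lt_trans (xk' k))// ltr_pdivrMr//.
by rewrite ltr_pMr ?mulr_gt0//; lra.
Qed.

Lemma cap_slope y w e : w <= 1 -> (forall k, `|y k| <= 1) -> cap y w e ->
  forall k, `|e ord0 (lift ord0 k)| <= 2 * e ord0 ord0.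
Proof.
move=> w1 y1 [/andP[e0 e1] ek] k.
have e00 : 0 < e ord0 ord0 by apply: lt_le_trans kap_gt0 _.
have h1 : `|e ord0 ord0 * y k| <= e ord0 ord0 by rewrite normrM gtr0_norm//
  ler_piMr// ltW.
have h2 : e ord0 ord0 * w <= e ord0 ord0 by rewrite ler_piMr// ltW.
have := ek k; move: h1; rewrite !ler_norml ltr_norml.
by move=> /andP[? ?] /andP[? ?]; apply/andP; split; lra.
Qed.

(** The tube lies in a sheared box along its own axis. The half-width [3 * D] is [D] for the
    distance to the axis plus [2 * D] for sliding along it to the same first coordinate, the slopes
    being at most 2. *)
Lemma lebesgue_tube_le y w e a (D : R) : 0 < D -> w <= 1 ->
  (forall k, `|y k| <= 1) -> cap y w e ->
  (lebesgue_rV d.+1 (tube D e a) <= ((1 + 2 * D) * (6 * D) ^+ d)%:E)%E.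
Proof.
move=> D0 w1 y1 ce; have slope := cap_slope _ _ _ w1 y1 ce.
have [/andP[e0 e1] _] := ce.
have e00 : 0 < e ord0 ord0 by apply: lt_le_trans kap_gt0 _.
pose s k := e ord0 (lift ord0 k) / e ord0 ord0.
have sle k : `|s k| <= 2.
  by rewrite /s normrM normfV (gtr0_norm e00) ler_pdivrMr.
have := @lebesgue_sheared_box R d (a ord0 ord0 - 2^-1 - D) (a ord0 ord0 + 2^-1 +
  D)
  (fun k => a ord0 (lift ord0 k) - a ord0 ord0 * s k) s (3 * D).
have -> : 2 * (3 * D) = 6 * D by ring.
have -> : a ord0 ord0 + 2^-1 + D - (a ord0 ord0 - 2^-1 - D) = 1 + 2 * D by
  field.
move=> <-; [|by lra|by lra].
apply: le_lebesgue_rV => x [z [t]]; rewrite /= in_itv/= => /andP[t1 t2] <- xD.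
have co i : `|x ord0 i - (a ord0 i + t * e ord0 i)| < D.
  by apply: le_lt_trans xD; have := coord_le_enorm (x - (a + t *: e)) i;
    rewrite !mxE.
have te : `|t * e ord0 ord0| <= 2^-1.
  rewrite normrM (gtr0_norm e00) -[leRHS]mulr1 ler_pM//; first by exact: ltW.
  by rewrite ler_norml t1.
split.
  have := co ord0; move: te; rewrite ler_norml ltr_norml.
  by move=> /andP[? ?] /andP[? ?]; apply/andP; split; lra.
move=> k; set u := x ord0 ord0 - (a ord0 ord0 + t * e ord0 ord0).
have uD : `|u| < D := co ord0.
have us : `|u * s k| <= 2 * D.
  rewrite normrM mulrC ler_pM//; exact: ltW.
have := co (lift ord0 k).
have ek : e ord0 (lift ord0 k) = e ord0 ord0 * s k by rewrite /s; field; lra.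
rewrite ek => h.
have -> : x ord0 (lift ord0 k) - (a ord0 (lift ord0 k) - a ord0 ord0 * s k + x
  ord0 ord0 * s k)
  = (x ord0 (lift ord0 k) - (a ord0 (lift ord0 k) + t * (e ord0 ord0 * s k))) -
    u * s k.
  by rewrite /u; ring.
by apply: le_trans (ler_normB _ _) _; lra.
Qed.

Lemma cube_sub_tube y w e q (c : 'I_d.+1 -> R) (r rho D : R) :
  cap y w e -> 0 <= w ->
  `|c ord0| <= (6 * d.+1%:R)^-1 ->
  (forall k, `|c (lift ord0 k) - (q k + c ord0 * y k)| <= r) ->
  0 <= r -> 0 <= rho ->
  d.+1%:R * (rho + r + `|c ord0| * w) < D ->
  cube c rho `<=` tube D e (cons_rV (0, \row_k q k)).
Proof.
move=> [/andP[e0 e1] ek] w0 c0 cr r0 rho0 lD x xc.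
have e00 : 0 < e ord0 ord0 by apply: lt_le_trans kap_gt0 _.
(* The point of the axis with the same first coordinate as [c]. The bound on [c ord0] is half the
   least value of [e ord0 ord0], whence [|t| <= 1 / 2]. *)
set t := c ord0 / e ord0 ord0.
have te : t * e ord0 ord0 = c ord0 by rewrite /t; field; lra.
exists (cons_rV (0, \row_k q k) + t *: e).
  exists t => //; rewrite /= in_itv/= -ler_norml /t normrM normfV (gtr0_norm
    e00).
  rewrite ler_pdivrMr//; apply: le_trans c0 _; apply:
    (@le_trans _ _ (2^-1 * kap)).
    rewrite /kap -invfM.
    by have -> : 2 * (3 * d.+1%:R) = 6 * d.+1%:R :> R by ring.
  by rewrite ler_pM2l.
apply: le_lt_trans lD; apply: enorm_le => i.
have co (u : 'rV[R]_d.+1) :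
    (x - (u + t *: e)) ord0 i = x ord0 i - (u ord0 i + t * e ord0 i).
  by rewrite !mxE.
rewrite co.
have cw : 0 <= `|c ord0| * w by rewrite mulr_ge0.
case: (unliftP ord0 i) => [k|] ->; last first.
  by rewrite cons_rV0E add0r te; apply: le_trans (xc ord0) _; lra.
rewrite cons_rVSE mxE.
have h : `|t * e ord0 (lift ord0 k) - c ord0 * y k| <= `|c ord0| * w.
  rewrite -te -[t * _ * y k]mulrA -mulrBr !normrM (gtr0_norm e00) -[leRHS]mulrA.
  by rewrite ler_wpM2l// ltW.
have := cr k; have := xc (lift ord0 k).
move: h; rewrite !ler_norml => /andP[? ?] /andP[? ?] /andP[? ?]; apply/andP;
  split; lra.
Qed.

End caps.

(** * The maximal inequality as an incidence bound *)

Section cubes.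
Context {R : realType} {d : nat} {Z : finType}.
Variables (c : Z -> 'I_d -> R) (rho : R) (S : {set Z}).
Hypothesis rho0 : 0 <= rho.
Hypothesis sep : {in S &, forall i j, i != j ->
  exists k, 2 * rho < `|c i k - c j k|}.

Definition cubes (B : {set Z}) : set 'rV[R]_d :=
  \bigcup_(z in [set` B]) cube (c z) rho.

Lemma measurable_cubes (B : {set Z}) : measurable (cubes B).
Proof.
by apply: fin_bigcup_measurable => // z _; exact: measurable_cube.
Qed.

Lemma lebesgue_cubes (B : {set Z}) : B \subset S ->
  lebesgue_rV d (cubes B) = (#|B|%:R * (2 * rho) ^+ d)%:E.
Proof.
move=> /fintype.subsetP BS; rewrite measure_fin_bigcup//; last 2 first.
- apply/trivIsetP => i j /= iB jB ij; apply/seteqP; split => // x [xi xj].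
  have [k] := sep _ _ (BS _ iB) (BS _ jB) ij; rewrite ltNge => /negP[].
  have := xi k; have := xj k.
  rewrite !ler_norml => /andP[? ?] /andP[? ?]; apply/andP; split; lra.
- by move=> i _; exact: measurable_cube.
rewrite (@fsbigE _ _ _ _ _ (enum B)) ?enum_uniq//; last 2 first.
- by move=> i /=; rewrite mem_enum.
- by move=> i /= iB; rewrite mem_enum iB.
rewrite (eq_bigr (fun=> ((2 * rho) ^+ d)%:E)); last first.
  by move=> i _; exact: lebesgue_cube.
rewrite big_enum_cond/= (eq_bigl (mem B)).
  by rewrite sumEFin sumr_const [RHS]EFinM [LHS]EFin_natmul mule_natl.
by move=> i; rewrite mem_setE andbb.
Qed.

End cubes.

Section caps_bound.
Context {R : realType} {d : nat} (p : R).
Hypothesis p1 : 1 < p.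
Context {Y : finType} (SY : {set Y}) (y : Y -> 'I_d -> R) (w : R) (v : Y -> R).
Hypothesis w0 : 0 < w <= 2^-1.
Hypothesis y1 : forall i k, `|y i k| <= 1.
Hypothesis v0 : forall i, 0 <= v i.
Hypothesis ysep : {in SY &, forall i j, i != j ->
  exists k, 2 * w <= `|y i k - y j k|}.

Lemma cap_disjoint (i j : Y) (e : 'rV[R]_d.+1) : i \in SY -> j \in SY ->
  cap (y i) w e -> cap (y j) w e -> i = j.
Proof.
move=> iS jS [/andP[e0 _] ei] [_ ej]; apply/eqP; apply/negPn/negP => ij.
have [k] := ysep _ _ iS jS ij; rewrite leNgt => /negP[].
have {}e0 : 0 < e ord0 ord0 by apply: lt_le_trans e0; rewrite invr_gt0 mulr_gt0.
have : `|e ord0 ord0 * (y i k - y j k)| < e ord0 ord0 * (2 * w).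
  have := ei k; have := ej k.
  rewrite !ltr_norml => /andP[? ?] /andP[? ?]; apply/andP; split; lra.
by rewrite normrM gtr0_norm// ltr_pM2l.
Qed.

Lemma Lnorm_caps_ge (F : 'rV[R]_d.+1 -> \bar R) :
  (forall i e, i \in SY -> cap (y i) w e -> ((v i)%:E <= F e)%E) ->
  (((3 * d.+1%:R)^-1 * ((3 * d.+1%:R)^-1 * w) ^+ d *
    \sum_(i in SY) v i `^ p)%:E <= 'N[surface_measure]_p%:E[F] `^ p)%E.
Proof.
move=> vF; have p0 : 0 < p := lt_trans ltr01 p1.
rewrite poweR_Lnorm ?gt_eqF//.
pose g e : \bar R := (\sum_(i <- enum SY) (v i `^ p)%:E * (\1_(cap (y i) w)
  e)%:E)%E.
have mcap i : measurable_fun setT (fun e => (\1_(cap (y i) w) e)%:E : \bar R).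
  apply/measurable_EFinP; apply: measurable_indic; exact: measurable_cap.
apply: (@le_trans _ _ (\int[surface_measure]_e g e)%E).
  rewrite ge0_integral_sum//; last 2 first.
  - move=> i; exact: emeasurable_funM.
  - by move=> i e _; rewrite mule_ge0// lee_fin// powR_ge0.
  rewrite mulr_sumr -sumEFin -big_enum/=.
  apply: lee_sum => i _.
  rewrite ge0_integralZl_EFin ?powR_ge0//.
  rewrite integral_indic// ?setIT; last exact: measurable_cap.
  rewrite mulrC EFinM lee_wpmul2l ?lee_fin ?powR_ge0//.
  exact: surface_cap_ge.
apply: ge0_le_integral_nomeas => e _.
  by apply: sume_ge0 => i _; rewrite mule_ge0// lee_fin// powR_ge0.
have [[i [iS ie]]|none] := pselect (exists i, i \in SY /\ cap (y i) w e).
  rewrite /g (bigD1_seq i) ?mem_enum ?enum_uniq//= big1_seq ?adde0.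
    rewrite indicE mem_set// mule1 -poweR_EFin gt0_ler_poweR//.
    - exact: ltW.
    - by rewrite in_itv/= lee_fin v0 leey.
    - by rewrite in_itv/= abse_ge0 leey.
    - by apply: le_trans (vF i e iS ie) (lee_abs _).
  move=> j /andP[ji]; rewrite mem_enum => jS.
  rewrite indicE memNset ?mule0// => je.
  by move: ji; rewrite (cap_disjoint _ _ _ jS iS je ie) eqxx.
rewrite /g big1_seq ?poweR_ge0// => i /andP[_]; rewrite mem_enum => iS.
by rewrite indicE memNset ?mule0// => ie; apply: none; exists i.
Qed.

End caps_bound.

Section cubes_function.
Context {R : realType} {d : nat} {Z : finType}.
Variables (c : Z -> 'I_d -> R) (rho : R) (S : {set Z}).
Hypothesis rho0 : 0 <= rho.
Hypothesis sep : {in S &, forall i j, i != j ->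
  exists k, 2 * rho < `|c i k - c j k|}.

Local Notation f := (\1_(cubes c rho S) : 'rV[R]_d -> R).

Lemma integral_cubes : (\int[lebesgue_rV d]_x `|f x|%:E =
  (#|S|%:R * (2 * rho) ^+ d)%:E)%E.
Proof.
transitivity (\int[lebesgue_rV d]_x (f x)%:E)%E.
  by apply: eq_integral => x _; rewrite ger0_norm.
rewrite integral_indic ?setIT; [|by []|exact: measurable_cubes].
exact: (lebesgue_cubes _ _ _ rho0 sep).
Qed.

Lemma locally_integrable_cubes : locally_integrable_rV f.
Proof.
split; first by apply: measurable_indic; exact: measurable_cubes.
move=> K _; apply: (@le_lt_trans _ _ (\int[lebesgue_rV d]_x `|f x|%:E)%E).
  by apply: ge0_subset_integral_nomeas => // x; rewrite lee_fin.
by rewrite integral_cubes ltry.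
Qed.

Lemma Lnorm_cubes (p : R) : 0 < p ->
  ('N[lebesgue_rV d]_p%:E[EFin \o f] `^ p = (#|S|%:R * (2 * rho) ^+ d)%:E)%E.
Proof.
move=> p0; rewrite poweR_Lnorm ?gt_eqF// -integral_cubes.
apply: eq_integral => x _ /=; rewrite indicE; case: (x \in _).
  by rewrite normr1 powR1.
by rewrite normr0 powR0// gt_eqF.
Qed.

Lemma kakeya_maximal_cubes_ge (T : {set Z}) (D v : R) (e a : 'rV[R]_d) :
  T \subset S -> cubes c rho T `<=` tube D e a -> 0 < v ->
  (lebesgue_rV d (tube D e a) <= v%:E)%E ->
  ((#|T|%:R * (2 * rho) ^+ d / v)%:E <= kakeya_maximal D f e)%E.
Proof.
move=> TS Tt v0 tv; apply: (@le_trans _ _ ((lebesgue_rV d (tube D e a))^-1 *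
    \int[lebesgue_rV d]_(x in tube D e a) `|f x|%:E)%E); last first.
  by apply: ereal_sup_ubound; exists a.
rewrite mulrC EFinM; apply: lee_pmul.
- by rewrite lee_fin invr_ge0 ltW.
- by rewrite lee_fin mulr_ge0// exprn_ge0// mulr_ge0.
- have -> : (v^-1)%:E = (v%:E)^-1%E by rewrite inver gt_eqF.
  by rewrite lee_pV2 ?inE// ?lee_fin ?ltW// measure_ge0.
apply: (@le_trans _ _ (\int[lebesgue_rV d]_(x in cubes c rho T) `|f x|%:E)%E);
  last by apply: ge0_subset_integral_nomeas => // x; rewrite lee_fin.
rewrite -(lebesgue_cubes _ _ _ rho0 sep T TS).
rewrite (eq_integral (cst 1%E)); last first.
  move=> x /set_mem [z /= zT xz]; rewrite indicE mem_set ?normr1//.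
  by exists z => //=; move/fintype.subsetP : TS; apply.
by rewrite integral_cst ?mul1e//; exact: measurable_cubes.
Qed.

End cubes_function.

(** The maximal inequality is tested, at width [1 / (6 L)], on the indicator of small disjoint cubes
    around the scaled points. For directions in the cap of radius [1 / (2 L)] about [y i], the
    average over a suitable tube is at least a constant times [#|inc i|], up to powers of [L]. Since
    the caps are disjoint this bounds the sum of the [p]-th powers of the [#|inc i|], and the power
    mean over the at most [L ^ d] lines bounds their sum. *)
Lemma kakeya_incidence (R : realType) (d : nat) (h p K eps : R) :
  kakeya_maximal_bound d.+1 h p -> 1 < p -> 0 < K -> 0 < eps ->
  exists2 C : R, 0 < C & forall (L : nat) (Y Z : finType) (SY : {set Y})
    (SZ : {set Z}) (y q : Y -> 'I_d -> R) (P : Z -> 'I_d.+1 -> R)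
    (inc : Y -> {set Z}), (0 < L)%N ->
  (forall i k, `|y i k| <= 1) ->
  {in SY &, forall i j, i != j -> exists k, L%:R^-1 <= `|y i k - y j k|} ->
  (#|SY| <= L ^ d)%N ->
  {in SZ, forall z, `|P z ord0| <= 1} ->
  {in SZ &, forall i j, i != j ->
     exists k, (8 * L%:R)^-1 <= `|P i k - P j k|} ->
  {in SY, forall i, inc i \subset SZ} ->
  {in SY, forall i z, z \in inc i -> forall k,
    `|P z (lift ord0 k) - (q i k + P z ord0 * y i k)| <= K / L%:R} ->
  \sum_(i in SY) #|inc i|%:R <=
    C * L%:R ^+ d.+1 * L%:R `^ (h + eps) * (#|SZ|%:R / L%:R ^+ d.+1) `^ p^-1.
Proof.
move=> maxbound p1 K0 eps0; have p0 : 0 < p := lt_trans ltr01 p1.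
have [C0 bound] := maxbound _ eps0.
pose D1 : R := d.+1%:R.
have D0 : 0 < D1 by rewrite ltr0n.
(* Scaling by [kap] makes the points [P z] near a line lie in one unit tube of
   width [1 / (6 L)] around it. *)
pose kap : R := (6 * D1 * (K + 2))^-1.
have kap0 : 0 < kap by rewrite invr_gt0 !mulr_gt0//; lra.
have kapE : kap * (6 * D1 * (K + 2)) = 1.
  by rewrite mulVf// gt_eqF// !mulr_gt0//; lra.
(* [s0] and [v0] are the lower bound for the measure of a cap and the volume of a cube, freed from
   their powers of [L]. *)
pose s0 : R := (3 * D1)^-1 * ((3 * D1)^-1 / 2) ^+ d.
have s00 : 0 < s0 by rewrite /s0 mulr_gt0 ?exprn_gt0 ?divr_gt0 ?invr_gt0
  ?mulr_gt0.
pose v0 : R := (kap / 16) ^+ d.+1.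
have v00 : 0 < v0 by rewrite exprn_gt0 ?divr_gt0.
(* The power of 6 comes from the width [1 / (6 L)]; [|C0| + 1] is positive whatever the sign of
   [C0]. *)
pose Cb : R := (`|C0| + 1) * 6 `^ (h + eps).
have Cb0 : 0 < Cb by rewrite mulr_gt0 ?powR_gt0// ltr_pwDr.
exists (3 * Cb / v0 * (v0 / s0) `^ p^-1).
  by rewrite !mulr_gt0 ?invr_gt0 ?powR_gt0 ?divr_gt0.
move=> L Y Z SY SZ y q P inc L0 y1 ysep SYL P1 Psep incS incP.
have l0 : 0 < L%:R :> R by rewrite ltr0n.
have l1 : 1 <= L%:R :> R by rewrite ler1n.
set l : R := L%:R in l0 l1 ysep Psep incP *.
pose Dl : R := (6 * l)^-1.
have li0 : 0 < l^-1 by rewrite invr_gt0.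
have li1 : l^-1 <= 1 by rewrite invf_le1.
have DlE : Dl = 6^-1 * l^-1 by rewrite /Dl invfM.
pose rho : R := kap / 32 * l^-1.
have rho0 : 0 < rho by rewrite mulr_gt0// divr_gt0.
pose c z k : R := kap * P z k.
pose w : R := 2^-1 * l^-1.
have csep : {in SZ &, forall i j, i != j ->
    exists k, 2 * rho < `|c i k - c j k|}.
  move=> i j iS jS ij; have [k hk] := Psep i j iS jS ij; exists k.
  rewrite /c -mulrBr normrM gtr0_norm//.
  apply: (@lt_le_trans _ _ (kap * (8 * l)^-1)); last by rewrite ler_pM2l.
  rewrite invfM /rho.
  have -> : 2 * (kap / 32 * l^-1) = kap * (16^-1 * l^-1) by field; lra.
  by rewrite ltr_pM2l// ltr_pM2r// ltf_pV2 ?posrE//; lra.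
pose V : R := (2 * rho) ^+ d.+1.
have VE : V = v0 / l ^+ d.+1.
  by rewrite /V /v0 -exprVn -exprMn; congr (_ ^+ _); rewrite /rho; field; lra.
have V0 : 0 < V by rewrite exprn_gt0// mulr_gt0.
(* What one cube adds to an average: its volume over a bound for the volume of the tube,
   [(1 + 2 * Dl) * (6 * Dl) ^+ d] with [6 * Dl = l^-1]. *)
pose a : R := V / (3 * l^-1 ^+ d).
have a0 : 0 < a by rewrite divr_gt0// mulr_gt0// exprn_gt0.
pose v i : R := #|inc i|%:R * a.
have v_ge0 i : 0 <= v i by rewrite mulr_ge0// ltW.
have w01 : 0 < w <= 2^-1.
  by rewrite mulr_gt0//= /w ler_piMr// invr_ge0.
have ysep' : {in SY &, forall i j, i != j ->
    exists k, 2 * w <= `|y i k - y j k|}.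
  move=> i j iS jS ij; have [k hk] := ysep i j iS jS ij; exists k.
  by rewrite /w mulrA mulfV ?mul1r.
pose f : 'rV[R]_d.+1 -> R := \1_(cubes c rho SZ).
have lb i e : i \in SY -> cap (y i) w e ->
    ((v i)%:E <= kakeya_maximal Dl f e)%E.
  move=> iS ie; rewrite /v /a mulrA.
  apply: (kakeya_maximal_cubes_ge c rho SZ (ltW rho0) csep (inc i) Dl _ e
    (cons_rV (0, \row_k (kap * q i k)))).
  - exact: incS.
  - move=> x [z /= zi]; apply: (cube_sub_tube _ _ _ _ (c z) (kap * (K / l)) _ _
    ie).
    + by rewrite mulr_ge0// ltW// invr_gt0.
    + rewrite /c normrM gtr0_norm//.
      apply: (@le_trans _ _ kap).
        by rewrite ler_piMr ?(ltW kap0)// P1// (fintype.subsetP (incS i iS)).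
      rewrite /kap lef_pV2 ?posrE ?mulr_gt0//; last lra.
      by rewrite ler_peMr ?mulr_ge0//; lra.
    + move=> k; rewrite /c -mulrA -mulrDr -mulrBr normrM (gtr0_norm kap0).
      by rewrite ler_pM2l// incP.
    + by rewrite mulr_ge0 ?divr_ge0 ?ltW.
    + exact: ltW.
    + rewrite -/D1.
      apply: (@le_lt_trans _ _ (D1 * (rho + kap * (K / l) + kap * w))).
        rewrite ler_pM2l// lerD2l ler_pM2r; last by case/andP: w01.
        rewrite /c normrM (gtr0_norm kap0) ler_piMr ?(ltW kap0)// P1//.
        exact: (fintype.subsetP (incS i iS)).
      (* [17 / 32] collects [1 / 32] from [rho] and [1 / 2] from [w]; the [K + 2] in [kap] leaves
         room for it. *)
      rewrite DlE; have -> : D1 * (rho + kap * (K / l) + kap * w) =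
          D1 * kap * (K + 17 / 32) * l^-1.
        by rewrite /rho /w; field; lra.
      rewrite ltr_pM2r//.
      apply: (@lt_le_trans _ _ (D1 * kap * (K + 2))).
        by rewrite ltr_pM2l ?mulr_gt0//; lra.
      have -> : 6^-1 = 6^-1 * (kap * (6 * D1 * (K + 2))) by rewrite kapE mulr1.
      by rewrite le_eqVlt; apply/orP; left; apply/eqP; field.
  - by rewrite mulr_gt0// exprn_gt0.
  - have w1 : w <= 1 by case/andP: w01 => _ w2; apply: le_trans w2 _; lra.
    apply: le_trans (lebesgue_tube_le (y i) w e _ Dl _ w1 (y1 i) ie) _.
      by rewrite DlE mulr_gt0.
    rewrite lee_fin DlE; have -> : 6 * (6^-1 * l^-1) = l^-1 by field; lra.
    by rewrite ler_pM2r ?exprn_gt0//; lra.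
have main : s0 / l ^+ d * \sum_(i in SY) v i `^ p <=
    (Cb * l `^ (h + eps)) `^ p * (#|SZ|%:R * V).
  have Dl01 : 0 < Dl < 1.
    by rewrite DlE mulr_gt0//=; lra.
  have Nf : ('N[lebesgue_rV d.+1]_p%:E[EFin \o f] `^ p = (#|SZ|%:R * V)%:E)%E.
    exact: (Lnorm_cubes c rho SZ (ltW rho0) csep p p0).
  have Cle : C0 * Dl `^ (- h - eps) <= Cb * l `^ (h + eps).
    have -> : - h - eps = - (h + eps) by ring.
    rewrite /Dl -powR_inv1; last by rewrite mulr_ge0// ltW.
    rewrite -powRrM mulN1r opprK powRM ?(ltW l0)// mulrA ler_pM2r ?powR_gt0//.
    rewrite ler_pM2r ?powR_gt0//; apply: le_trans (ler_norm _) _; lra.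
  have Fle : ('N[surface_measure]_p%:E[kakeya_maximal Dl f] <=
      (Cb * l `^ (h + eps))%:E * 'N[lebesgue_rV d.+1]_p%:E[EFin \o f])%E.
    have lic := locally_integrable_cubes c rho SZ (ltW rho0) csep.
    apply: le_trans (bound f lic Dl Dl01) _.
    by rewrite lee_wpmul2r ?lee_fin// Lnorm_ge0.
  have Cbl : 0 <= Cb * l `^ (h + eps) by rewrite mulr_ge0 ?powR_ge0// ltW.
  have Fp : ('N[surface_measure]_p%:E[kakeya_maximal Dl f] `^ p <=
      ((Cb * l `^ (h + eps))%:E * 'N[lebesgue_rV d.+1]_p%:E[EFin \o f]) `^ p)%E.
    apply: gt0_ler_poweR => //; first exact: ltW.
      by rewrite in_itv/= Lnorm_ge0 leey.
    by rewrite in_itv/= leey andbT mule_ge0// Lnorm_ge0.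
  have := Lnorm_caps_ge _ p1 SY y w v w01 y1 v_ge0 ysep' _ lb.
  move=> /le_trans /(_ Fp).
  rewrite poweRM ?Lnorm_ge0 ?lee_fin// Nf poweR_EFin -EFinM lee_fin.
  apply: le_trans; rewrite le_eqVlt; apply/orP; left; apply/eqP.
  by rewrite /s0 -/D1 -exprVn /w -[_ * l^-1 ^+ d]mulrA -exprMn !mulrA.
have vE : \sum_(i in SY) v i `^ p =
    a `^ p * \sum_(i in SY) #|inc i|%:R `^ p.
  rewrite mulr_sumr; apply: eq_bigr => i _.
  by rewrite /v powRM ?(ltW a0)// mulrC.
have ap0 : 0 < a `^ p by rewrite powR_gt0.
have ld0 : 0 < l ^+ d by rewrite exprn_gt0.
have ld10 : 0 < l ^+ d.+1 by rewrite exprn_gt0.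
have SYl : #|SY|%:R <= l ^+ d by rewrite -natrX ler_nat.
apply: le_trans (sum_le_power_mean_card _ SY _ p _ p1 _ SYl) _ => //.
set A : R := \sum_(i in SY) #|inc i|%:R `^ p in vE *.
set B := Cb * l `^ (h + eps) in main *.
have B0 : 0 < B by rewrite mulr_gt0// powR_gt0.
set N : R := #|SZ|%:R in main *.
have N0 : 0 <= N by [].
have A_ge0 : 0 <= A by apply: sumr_ge0 => i _; exact: powR_ge0.
have {}main : A / l ^+ d <= (B / a) `^ p * (v0 / s0 * (N / l ^+ d.+1)).
  have -> : (B / a) `^ p = B `^ p / a `^ p.
    by rewrite powRM ?invr_ge0 ?(ltW a0) ?(ltW B0)// -[a^-1]powR_inv1 ?(ltW
      a0)// powRAC powR_inv1 ?powR_ge0.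
  move: main; rewrite vE VE => main.
  have -> : A / l ^+ d = (s0 / l ^+ d * (a `^ p * A)) * (s0^-1 / a `^ p).
    by field; rewrite !gt_eqF.
  have -> : B `^ p / a `^ p * (v0 / s0 * (N / l ^+ d.+1)) =
      (B `^ p * (N * (v0 / l ^+ d.+1))) * (s0^-1 / a `^ p).
    by field; rewrite !gt_eqF.
  by rewrite ler_pM2r// divr_gt0// invr_gt0.
have {}main : (A / l ^+ d) `^ p^-1 <=
    B / a * ((v0 / s0) `^ p^-1 * (N / l ^+ d.+1) `^ p^-1).
  have vs0 : 0 <= v0 / s0 by rewrite divr_ge0 ?ltW.
  have Nl0 : 0 <= N / l ^+ d.+1 by rewrite divr_ge0// ltW.
  have Ba0 : 0 <= B / a by rewrite divr_ge0 ?ltW.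
  have BaE : B / a = ((B / a) `^ p) `^ p^-1.
    by rewrite -powRrM mulfV ?gt_eqF// powRr1.
  have Bp0 : 0 <= (B / a) `^ p by exact: powR_ge0.
  have vN0 : 0 <= v0 / s0 * (N / l ^+ d.+1) by exact: mulr_ge0.
  rewrite -powRM// [in leRHS]BaE -powRM//.
  apply: ge0_ler_powR => //; rewrite ?invr_ge0 ?nnegrE ?(ltW p0)//.
    by rewrite divr_ge0// ltW.
  exact: mulr_ge0.
apply: (@le_trans _ _ (l ^+ d * (B / a *
    ((v0 / s0) `^ p^-1 * (N / l ^+ d.+1) `^ p^-1)))); first by rewrite ler_pM2l.
rewrite le_eqVlt; apply/orP; left; apply/eqP.
have -> : a = v0 / (3 * l).
  by rewrite /a VE exprVn exprS; field; rewrite !gt_eqF.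
by rewrite /B exprS; field; rewrite !gt_eqF.
Qed.

(** * Projection from a base point *)

Section projection.
Context {R : realType}.

(* Lines [b + t (1, y)] and [a + s (1, z)] that nearly meet at [s] away from
   [0]: the direction of [z - y] is then close to one determined by [y], [a]
   and [b]. *)
Lemma near_meet_ratio (lam K M L ai bi ak bk a0 b0 yi yk : R) :
  0 < lam -> 0 < K -> 0 < M -> 0 < L ->
  0 <= yi <= M -> 0 <= yk <= M ->
  exists r : R, forall zi zk s t : R,
    L <= `|zi - yi| -> `|zk - yk| <= 2 * L -> lam <= s ->
    `|a0 + s - b0 - t| <= K / M ->
    `|ai + s * (zi / M) - bi - t * (yi / M)| <= K / M ->
    `|ak + s * (zk / M) - bk - t * (yk / M)| <= K / M ->
    `|(zk - yk) / (zi - yi) - r| <= 12 * K / lam / L.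
Proof.
move=> lam0 K0 M0 L0 yiM ykM.
(* At an exact meeting [t = a0 + s - b0], and eliminating [t] gives [s * (z - y) = - A c d y]. The
   quotient of two such equations is free of [s]. *)
pose A c d y := M * (c - d) - y * (a0 - b0) : R.
have err z y c d s t : 0 <= y <= M -> `|a0 + s - b0 - t| <= K / M ->
    `|c + s * (z / M) - d - t * (y / M)| <= K / M ->
    `|s * (z - y) + A c d y| <= 2 * K.
  move=> /andP[y0 yM] h0 h.
  have -> : s * (z - y) + A c d y = M * (c + s * (z / M) - d - t * (y / M)) -
      y * (a0 + s - b0 - t) by rewrite /A; field; lra.
  apply: le_trans (ler_normB _ _) _; rewrite !normrM (gtr0_norm M0) (ger0_norm
    y0).
  have h1 : M * `|c + s * (z / M) - d - t * (y / M)| <= M * (K / M) by rewrite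
    ler_pM2l.
  have h2 : y * `|a0 + s - b0 - t| <= M * (K / M) by rewrite ler_pM.
  have : M * (K / M) = K by field; lra.
  lra.
(* If [A ai bi yi] is small then [lam * L < 4 * K], so the allowed error exceeds 2, which already
   bounds the ratio, and 0 will do. *)
exists (if lam * L / 2 <= `|A ai bi yi| then A ak bk yk / A ai bi yi else 0).
move=> zi zk s t hL h2L hs h0 hi hk.
have s0 : 0 < s by lra.
have ei := err _ _ _ _ _ _ yiM h0 hi; have ek := err _ _ _ _ _ _ ykM h0 hk.
have zy0 : zi - yi != 0 by rewrite -normr_gt0; lra.
set r := (zk - yk) / (zi - yi).
have r2 : `|r| <= 2.
  rewrite /r normrM normfV ler_pdivrMr ?normr_gt0//; apply: le_trans h2L _.
  by rewrite ler_pM2l.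
case: ifPn => [Ai|].
  have A0 : A ai bi yi != 0.
    by rewrite -normr_gt0 (lt_le_trans _ Ai)// divr_gt0// mulr_gt0.
  have -> : r - A ak bk yk / A ai bi yi =
     (r * (s * (zi - yi) + A ai bi yi) - (s * (zk - yk) + A ak bk yk)) / A ai bi
       yi.
    by rewrite /r; field; rewrite A0.
  rewrite normrM normfV ler_pdivrMr ?normr_gt0//.
  apply: le_trans (ler_normB _ _) _; rewrite normrM.
  have h : `|r| * `|s * (zi - yi) + A ai bi yi| <= 2 * (2 * K) by rewrite
    ler_pM.
  have h' : 12 * K / lam / L * (lam * L / 2) <= 12 * K / lam / L * `|A ai bi
    yi|.
    by rewrite ler_pM2l// !divr_gt0// mulr_gt0.
  have : 12 * K / lam / L * (lam * L / 2) = 6 * K by field; lra.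
  lra.
rewrite -ltNge subr0 => Ai; apply: le_trans r2 _.
rewrite !ler_pdivlMr//.
have : lam * L <= `|s * (zi - yi)| by rewrite normrM (gtr0_norm s0) ler_pM//;
  lra.
have := lerB_normD (s * (zi - yi)) (A ai bi yi).
lra.
Qed.

End projection.

Section pairs.
Context {R : realType} {d M N : nat}.
Local Notation dir := {ffun 'I_d.+1 -> 'I_M}.
Variables (b : 'I_N -> 'I_d.+2 -> R) (al : dir -> 'I_N) (lam K : R).

(* The bound [lam <= s] keeps the near intersection away from the base point of
   [q'], from which we project. *)
Definition near_meet (q q' : dir) : Prop := exists s t : R,
  [/\ lam <= s, `|b (al q') ord0 + s - b (al q) ord0 - t| <= K / M%:R &
  forall k, `|b (al q') (lift ord0 k) + s * ((q' k)%:R / M%:R)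
             - b (al q) (lift ord0 k) - t * ((q k)%:R / M%:R)| <= K / M%:R].

Definition near_meets (D : {set dir}) (i : 'I_d.+1) (L : nat) (q : dir) :
    {set dir} :=
  [set q' in D | [&& `[< near_meet q q' >],
    (L%:R : R) <= `|(q' i)%:R - (q i)%:R|, `|(q' i)%:R - (q i)%:R| < (2 * L%:R :
      R) &
    [forall k, `|(q' k)%:R - (q k)%:R| < (2 * L%:R : R)]]].

(** First directions of a pair. Fixing [q i = t] makes the projected image of the second direction
    independent of the first. *)
Definition dir_cell (D : {set dir}) (i : 'I_d.+1) (L : nat) (Q : 'I_d.+1 -> nat)
    (t : nat) : {set dir} :=
  [set q in D | [forall k, (L * Q k <= q k < L * Q k + L)%N] &&
    (q i == t :> nat)].

(** Second directions, based at [a], that can be paired with the cell: within [2 * L] of a direction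
    of the box, hence within [3 * L] of its corner. *)
Definition dir_near (D : {set dir}) (i : 'I_d.+1) (L : nat) (Q : 'I_d.+1 -> nat)
    (t : nat) (a : 'I_N) : {set dir} :=
  [set q in D | [&& [forall k, `|(q k)%:R - (L * Q k)%:R| <= 3 * L%:R :> R],
    al q == a, (L%:R : R) <= `|(q i)%:R - t%:R| &
    `|(q i)%:R - t%:R| < (2 * L%:R : R)]].

Lemma card_dir_cell D i L Q t : (0 < L)%N -> (#|dir_cell D i L Q t| <= L ^ d)%N.
Proof.
move=> L0; pose F (q : dir) : {ffun 'I_d -> 'I_L} :=
  [ffun k => Ordinal (ltn_pmod (q (lift i k)) L0)].
rewrite -[leqRHS](_ : #|{ffun 'I_d -> 'I_L}| = _)%N; last first.
  by rewrite card_ffun !card_ord.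
rewrite -(@card_in_imset _ _ F); first exact: max_card.
move=> q q'; rewrite !inE => /andP[_ /andP[/forallP qQ /eqP qt]].
move=> /andP[_ /andP[/forallP q'Q /eqP q't]] /ffunP FE; apply/ffunP => k.
apply: val_inj => /=; case: (unliftP i k) => [k'|] ->; last by rewrite qt q't.
have := FE k'; rewrite !ffunE => /(congr1 val) /=.
have mE (r : dir) : (L * Q (lift i k') <= r (lift i k') < L * Q (lift i k') +
  L)%N ->
    (r (lift i k') %% L = r (lift i k') - L * Q (lift i k'))%N.
  move=> /andP[r1 r2]; rewrite -{1}(subnKC r1) mulnC modnMDl modn_small//.
  lia.
rewrite !mE// => e; have /andP[h _] := qQ (lift i k').
have /andP[h' _] := q'Q (lift i k').
by rewrite -(subnKC h) e subnKC.
Qed.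

(** Each direction has one base point, so the sets for distinct [a] are disjoint, and an offset from
    the corner takes at most [6 * L + 1 <= 7 * L] values. *)
Lemma card_dir_near D i L Q t : (0 < L)%N ->
  (\sum_a #|dir_near D i L Q t a| <= (7 * L) ^ d.+1)%N.
Proof.
move=> L0.
pose S : {set dir} :=
  [set q : dir | [forall k, `|(q k)%:R - (L * Q k)%:R| <= 3 * L%:R :> R]]%SET.
apply: (@leq_trans #|S|).
  rewrite -sum1_card (partition_big al xpredT)//=; apply: leq_sum => a _.
  rewrite sum1_card; apply/subset_leq_card/fintype.subsetP => q.
  rewrite inE => /andP[_ /and4P[h1 /eqP<- _ _]].
  by apply/andP; split => //; rewrite inE.
have [n nE] : exists n, (7 * L = n.+1)%N by exists (7 * L).-1;
  rewrite prednK// muln_gt0.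
pose F (q : dir) : {ffun 'I_d.+1 -> 'I_n.+1} :=
  [ffun k => inord (q k + 3 * L - L * Q k)].
have -> : ((7 * L) ^ d.+1 = #|{ffun 'I_d.+1 -> 'I_n.+1}|)%N.
  by rewrite card_ffun !card_ord nE.
rewrite -(@card_in_imset _ _ F); first exact: max_card.
have bnd (q : dir) : q \in S -> forall k,
    (q k <= L * Q k + 3 * L /\ L * Q k <= q k + 3 * L)%N.
  rewrite inE => /forallP H k; have := H k.
  rewrite ler_norml => /andP[h1 h2]; split.
    by rewrite -(ler_nat R) natrD [(3 * L)%:R]natrM; lra.
  by rewrite -(ler_nat R) natrD [(3 * L)%:R]natrM; lra.
move=> q q' qS q'S /ffunP FE; apply/ffunP => k; apply: val_inj => /=.
have [h1 h2] := bnd _ qS k; have [h3 h4] := bnd _ q'S k.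
have := FE k; rewrite !ffunE => /(congr1 val) /=.
move: (q k : nat) (q' k : nat) (L * Q k)%N h1 h2 h3 h4 => x x' y h1 h2 h3 h4.
by rewrite !inordK; lia.
Qed.

End pairs.

(** For [a] and [a'] the distances of two entries from [t], this separates the first coordinates of
    the projected points. *)
Lemma inv_dist_ge (R : realType) (a a' l : R) : 0 < l ->
  l <= `|a| < 2 * l -> l <= `|a'| < 2 * l -> 1 <= `|a - a'| ->
  (8 * l)^-1 <= `|l / a - l / a'|.
Proof.
move=> l0 /andP[a1 a2] /andP[b1 b2] ab.
have a0 : a != 0 by rewrite -normr_gt0; lra.
have b0 : a' != 0 by rewrite -normr_gt0; lra.
have -> : l / a - l / a' = - (l * (a - a') / (a * a')) by field; rewrite b0 a0.
rewrite normrN !normrM normfV normrM (gtr0_norm l0) -div1r.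
rewrite ler_pdivrMr; last lra.
rewrite mulrAC ler_pdivlMr ?mul1r; last by rewrite mulr_gt0 ?normr_gt0.
apply: (@le_trans _ _ ((2 * l) * (2 * l))); first by rewrite ler_pM// ltW.
apply: (@le_trans _ _ (l * 1 * (8 * l))); first by nra.
by rewrite ler_pM2r ?ler_pM2l//; lra.
Qed.

Lemma natr_dist_ge1 (R : realType) (m n : nat) :
  m != n -> 1 <= `|m%:R - n%:R : R|.
Proof.
case: (ltngtP m n) => // mn _; last first.
  by rewrite ger0_norm ?subr_ge0 ?ler_nat 1?ltnW// -natrB 1?ltnW// ler1n
    subn_gt0.
rewrite distrC.
by rewrite ger0_norm ?subr_ge0 ?ler_nat 1?ltnW// -natrB 1?ltnW// ler1n subn_gt0.
Qed.

(** By [near_meet_ratio], [(q' k - q k) / (q' i - t)] is within [O(1 / L)] of a number that depends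
    only on [q] and [a]. Splitting [q k] into the corner [L * Q k] and [L] times a slope, this says
    that a point depending only on [q'] is close to a line depending only on [q]: an incidence for
    [kakeya_incidence]. *)
Lemma near_meets_cell (R : realType) (d : nat) (h p lam K eps : R) :
  kakeya_maximal_bound d.+1 h p -> 1 < p -> 0 < lam -> 0 < K -> 0 < eps ->
  exists2 C : R, 0 < C & forall (M N : nat) (b : 'I_N -> 'I_d.+2 -> R)
    (al : {ffun 'I_d.+1 -> 'I_M} -> 'I_N) (D : {set {ffun 'I_d.+1 -> 'I_M}})
    (i : 'I_d.+1) (L : nat) (Q : 'I_d.+1 -> nat) (t : nat) (a : 'I_N),
  (0 < L)%N ->
  \sum_(q in dir_cell D i L Q t)
     #|[set q' in near_meets b al lam K D i L q | al q' == a]%SET|%:R <=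
    C * L%:R ^+ d.+1 * L%:R `^ (h + eps) *
    (#|dir_near (R := R) al D i L Q t a|%:R / L%:R ^+ d.+1) `^ p^-1.
Proof.
move=> maxbound p1 lam0 K0 eps0.
have K'0 : 0 < 12 * K / lam by rewrite divr_gt0 ?mulr_gt0.
have [C C0 bound] := kakeya_incidence _ _ _ _ _ _ maxbound p1 K'0 eps0.
exists C => // M N b al D i L Q t a L0.
have l0 : 0 < L%:R :> R by rewrite ltr0n.
pose dir := {ffun 'I_d.+1 -> 'I_M}.
(* [P q] is the image under the projection from [b a] of the line through [b a]
   with direction [q]. *)
pose y (q : dir) (k : 'I_d) : R := ((q (lift i k) %% L)%N)%:R / L%:R.
pose P (q : dir) (k : 'I_d.+1) : R :=
  (if unlift ord0 k is Some k' then (q (lift i k'))%:R - (L * Q (lift i k'))%:R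
   else L%:R) / ((q i)%:R - t%:R).
have P0 q : P q ord0 = L%:R / ((q i)%:R - t%:R) by rewrite /P unlift_none.
have PS q k : P q (lift ord0 k) =
    ((q (lift i k))%:R - (L * Q (lift i k))%:R) / ((q i)%:R - t%:R).
  by rewrite /P liftK.
(* [y] uses remainders so that its bound by 1 holds for every direction, as [kakeya_incidence] asks;
   on the cell a remainder is the offset from the corner. *)
have cellE q k : q \in dir_cell D i L Q t ->
    ((q (lift i k) %% L)%N)%:R = (q (lift i k))%:R - (L * Q (lift i k))%:R :> R.
  rewrite inE => /andP[_ /andP[/forallP/(_ (lift i k)) /andP[h1 h2] _]].
  rewrite -natrB//; congr (_%:R).
  rewrite -{1}(subnKC h1) mulnC modnMDl modn_small//; lia.
have exr (q : dir) : exists r : 'I_d -> R, q \in dir_cell D i L Q t ->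
    forall q', q' \in near_meets b al lam K D i L q -> al q' = a ->
    forall k, `|((q' (lift i k))%:R - (q (lift i k))%:R) /
                ((q' i)%:R - (q i)%:R) - r k| <= 12 * K / lam / L%:R.
  have M0 : 0 < M%:R :> R by rewrite ltr0n (leq_ltn_trans _ (ltn_ord (q i))).
  have qM k : (0 : R) <= (q k)%:R <= (M%:R : R) by rewrite ler0n ler_nat ltnW.
  have H k := near_meet_ratio lam K M%:R L%:R (b a (lift ord0 i)) (b (al q)
    (lift ord0 i))
    (b a (lift ord0 (lift i k))) (b (al q) (lift ord0 (lift i k)))
    (b a ord0) (b (al q) ord0) (q i)%:R (q (lift i k))%:R lam0 K0 M0 l0
    (qM i) (qM (lift i k)).
  pose r k := projT1 (cid (H k)); exists r => _ q' q'q q'a k.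
  move: q'q; rewrite inE => /andP[_ /and4P[/asboolP[s [u [s1 h0 hk]]] h1 h2
    /forallP h3]].
  rewrite /r; case: (cid _) => /= r0 /(_ _ _ s u h1 (ltW (h3 (lift i k))) s1).
  by rewrite -q'a => /(_ h0 (hk _) (hk _)).
pose q0 (q : dir) : 'I_d -> R := projT1 (cid (exr q)).
have q0P q : q \in dir_cell D i L Q t ->
    forall q', q' \in near_meets b al lam K D i L q -> al q' = a ->
    forall k, `|((q' (lift i k))%:R - (q (lift i k))%:R) /
                ((q' i)%:R - (q i)%:R) - q0 q k| <= 12 * K / lam / L%:R.
  by rewrite /q0; case: (cid _).
apply: (bound L _ _ _ _ y q0 P) => //.
- move=> q k; rewrite /y normrM normfV !ger0_norm// ler_pdivrMr// mul1r.
  by rewrite ler_nat ltnW// ltn_pmod.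
- move=> q q' qS q'S qq'.
  have [k qk] : exists k, q (lift i k) != q' (lift i k).
    apply/existsP; apply: contraNT qq' => /existsPn H; apply/eqP/ffunP => k.
    case: (unliftP i k) => [k'|] ->; first by have := H k';
      rewrite negbK => /eqP.
    apply: val_inj => /=; move: qS q'S; rewrite !inE.
    by move=> /andP[_ /andP[_ /eqP->]] /andP[_ /andP[_ /eqP->]].
  exists k; rewrite /y !cellE// -mulrBl normrM normfV (gtr0_norm l0).
  rewrite -[leLHS]mul1r ler_pM2r ?invr_gt0//.
  rewrite (_ : _ - _ - _ = (q (lift i k))%:R - (q' (lift i k))%:R);
    last by ring.
  exact: natr_dist_ge1.
- exact: card_dir_cell.
- move=> z; rewrite inE => /andP[_ /and4P[_ _ h1 h2]]; rewrite P0 normrM normfV.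
  by rewrite (gtr0_norm l0) ler_pdivrMr ?mul1r// (lt_le_trans l0).
- move=> q q'; rewrite !inE => /andP[_ /and4P[_ _ h1 h2]] /andP[_ /and4P[_ _ h3
  h4]] qq'.
  (* With equal [i]-th entries another entry differs, by at least 1 over a common denominator below
     [2 * L]; otherwise the first coordinates are separated. *)
  have [qi|qi] := eqVneq (q i) (q' i).
    have [k qk] : exists k, q (lift i k) != q' (lift i k).
      apply/existsP; apply: contraNT qq' => /existsPn H; apply/eqP/ffunP => k.
      by case: (unliftP i k) => [k'|] ->//; have := H k'; rewrite negbK => /eqP.
    exists (lift ord0 k); rewrite !PS qi -mulrBl normrM normfV.
    rewrite (_ : _ - _ - _ = (q (lift i k))%:R - (q' (lift i k))%:R);
      last by ring.
    apply: (@le_trans _ _ (1 * (8 * L%:R)^-1)); first by rewrite mul1r.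
    rewrite ler_pM ?invr_ge0 ?natr_dist_ge1// ?mulr_ge0//.
    by rewrite lef_pV2 ?posrE ?mulr_gt0//; clear -l0 h3 h4; lra.
  exists ord0; rewrite !P0; apply: inv_dist_ge; rewrite ?h1 ?h3//.
  rewrite (_ : _ - _ - _ = (q i)%:R - (q' i)%:R); last by ring.
  exact: natr_dist_ge1.
- move=> q; rewrite inE => /andP[_ /andP[/forallP qQ /eqP qt]].
  apply/fintype.subsetP => q'; rewrite !inE.
  move=> /andP[/andP[-> /and4P[_ h1 h2 /forallP h3]] ->];
    rewrite -qt h1 h2 !andbT/=.
  apply/forallP => k; have := h3 k; have /andP[] := qQ k.
  rewrite -(ler_nat R) -(ltr_nat R) natrD => h4 h5.
  rewrite ltr_norml ler_norml => /andP[u1 u2].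
  by apply/andP; split; clear -h4 h5 u1 u2; lra.
- move=> q qS q' ; rewrite inE => /andP[q'q /eqP q'a] k.
  have := q0P q qS q' q'q q'a k; congr (`| _ | <= _).
  rewrite PS P0 /y cellE//.
  have /andP[_ /andP[_ /eqP qt]] : (q \in D) && ([forall k, (L * Q k <= q k < L
    * Q k + L)%N] &&
    (q i == t :> nat)) by move: qS; rewrite inE.
  have : (q' i)%:R - (q i)%:R != 0 :> R.
    move: q'q; rewrite inE => /andP[_ /and4P[_ h1 _ _]].
    by rewrite -normr_gt0 (lt_le_trans l0).
  by rewrite qt => qi0; field; rewrite qi0 gt_eqF.
Qed.

(** The sets [dir_near] have at most [(7 * L) ^ d.+1] directions in total, so the [p]-th powers of
    the [N] summands add up to at most [7 ^ d.+1]. *)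
Lemma near_meets_cell_sum (R : realType) (d : nat) (h p lam K eps : R) :
  kakeya_maximal_bound d.+1 h p -> 1 < p -> 0 < lam -> 0 < K -> 0 < eps ->
  exists2 C : R, 0 < C & forall (M N : nat) (b : 'I_N -> 'I_d.+2 -> R)
    (al : {ffun 'I_d.+1 -> 'I_M} -> 'I_N) (D : {set {ffun 'I_d.+1 -> 'I_M}})
    (i : 'I_d.+1) (L : nat) (Q : 'I_d.+1 -> nat) (t : nat),
  (0 < L)%N -> (0 < N)%N ->
  \sum_(q in dir_cell D i L Q t) #|near_meets b al lam K D i L q|%:R <=
    C * L%:R ^+ d.+1 * L%:R `^ (h + eps) * N%:R `^ (1 - p^-1).
Proof.
move=> maxbound p1 lam0 K0 eps0; have p0 : 0 < p := lt_trans ltr01 p1.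
have [C C0 bound] := near_meets_cell _ _ _ _ _ _ _ maxbound p1 lam0 K0 eps0.
exists (C * (7 ^+ d.+1) `^ p^-1); first by rewrite mulr_gt0 ?powR_gt0
  ?exprn_gt0.
move=> M N b al D i L Q t L0 N0.
have l0 : 0 < L%:R :> R by rewrite ltr0n.
have n0 : 0 < N%:R :> R by rewrite ltr0n.
pose x (a : 'I_N) : R := (#|dir_near (R := R) al D i L Q t a|%:R / L%:R ^+ d.+1)
  `^ p^-1.
apply: (@le_trans _ _ (\sum_(a in [set: 'I_N]%SET)
    C * L%:R ^+ d.+1 * L%:R `^ (h + eps) * x a)).
  apply: (@le_trans _ _ (\sum_(a in [set: 'I_N]%SET) \sum_(q in dir_cell D i L Q
    t)
     #|[set q' in near_meets b al lam K D i L q | al q' == a]%SET|%:R));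
       last first.
    by apply: ler_sum => a _; exact: bound.
  rewrite exchange_big/=; apply: ler_sum => q _.
  rewrite -natr_sum ler_nat -sum1_card (partition_big al xpredT)//=.
  rewrite big_mkcond [leqRHS]big_mkcond; apply: leq_sum => a _; rewrite inE.
  by rewrite sum1_card; apply/subset_leq_card/fintype.subsetP => q1 /andP[h1
    h2]; rewrite inE h1 h2.
rewrite -mulr_sumr.
have xsum : \sum_(a in [set: 'I_N]%SET) x a <= (7 ^+ d.+1) `^ p^-1 * N%:R `^ (1
  - p^-1).
  have cN : #|[set: 'I_N]%SET|%:R <= N%:R :> R by rewrite cardsT card_ord.
  apply: le_trans (sum_le_power_mean_card _ _ x p N%:R p1 _ cN) _.
    by move=> a; exact: powR_ge0.
  have xp a : x a `^ p = #|dir_near (R := R) al D i L Q t a|%:R / L%:R ^+ d.+1.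
    rewrite /x -powRrM mulVf ?gt_eqF// powRr1// divr_ge0// exprn_ge0//.
  under eq_bigr do rewrite xp.
  rewrite -mulr_suml.
  have -> : (7 ^+ d.+1) `^ p^-1 * N%:R `^ (1 - p^-1) =
      N%:R * (7 ^+ d.+1 / N%:R) `^ p^-1 :> R.
    rewrite powRM ?exprn_ge0 ?invr_ge0 ?(ltW n0)// powRD; last first.
      by rewrite (gt_eqF n0) implybT.
    rewrite powRr1 ?(ltW n0)// powRN -[(N%:R)^-1]powR_inv1 ?(ltW n0)//.
    by rewrite powRAC powR_inv1 ?powR_ge0//; ring.
  rewrite ler_pM2l// ge0_ler_powR ?invr_ge0 ?(ltW p0)// ?nnegrE.
  - by rewrite !divr_ge0 ?exprn_ge0// sumr_ge0.
  - by rewrite divr_ge0 ?exprn_ge0.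
  - rewrite ler_pM2r ?invr_gt0// ler_pdivrMr ?exprn_gt0// -exprMn.
    rewrite -natr_sum -natrM -natrX ler_nat.
    apply: leq_trans (card_dir_near al D i L Q t L0).
    by rewrite big_mkcond; apply: leq_sum => a _; case: ifP.
rewrite [leRHS](_ : _ = C * L%:R ^+ d.+1 * L%:R `^ (h + eps) *
  ((7 ^+ d.+1) `^ p^-1 * N%:R `^ (1 - p^-1))); last by ring.
by rewrite ler_pM2l// !mulr_gt0 ?powR_gt0 ?exprn_gt0.
Qed.

(** The directions split into [M' ^ d.+1 * L] cells, one for each box of side [L] and each residue
    of the [i]-th entry; as [M' * L = M], all but one factor [L] is absorbed into [M ^ d.+1]. *)
Lemma near_meets_sum (R : realType) (d : nat) (h p lam K eps : R) :
  kakeya_maximal_bound d.+1 h p -> 1 < p -> 0 < lam -> 0 < K -> 0 < eps ->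
  exists2 C : R, 0 < C & forall (M N : nat) (b : 'I_N -> 'I_d.+2 -> R)
    (al : {ffun 'I_d.+1 -> 'I_M} -> 'I_N) (D : {set {ffun 'I_d.+1 -> 'I_M}})
    (i : 'I_d.+1) (L M' : nat),
  (0 < L)%N -> (0 < N)%N -> M = (M' * L)%N ->
  \sum_(q in D) #|near_meets b al lam K D i L q|%:R <=
    C * M%:R ^+ d.+1 * L%:R * L%:R `^ (h + eps) * N%:R `^ (1 - p^-1).
Proof.
move=> maxbound p1 lam0 K0 eps0; have p0 : 0 < p := lt_trans ltr01 p1.
have [C C0 bound] := near_meets_cell_sum _ _ _ _ _ _ _ maxbound p1 lam0 K0 eps0.
exists C => // M N b al D i L M' L0 N0 ME.
pose g q : R := #|near_meets b al lam K D i L q|%:R.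
have quo (q : {ffun 'I_d.+1 -> 'I_M}) k : (q k %/ L < M')%N.
  by rewrite ltn_divLR// -ME.
pose T := ({ffun 'I_d.+1 -> 'I_M'} * 'I_L)%type.
pose key (q : {ffun 'I_d.+1 -> 'I_M}) : T :=
  ([ffun k => Ordinal (quo q k)], Ordinal (ltn_pmod (q i) L0)).
pose cell (u : T) := dir_cell D i L (fun k => u.1 k) (L * u.1 i + u.2).
apply: (@le_trans _ _ (\sum_(u : T) \sum_(q in cell u) g q)).
  rewrite (partition_big key xpredT)//=; apply: ler_sum => u _.
  rewrite big_mkcond [leRHS]big_mkcond; apply: ler_sum => q _.
  case: ifPn => [/andP[qD /eqP <-]|_]; last by case: ifP.
  rewrite ifT// inE qD /=; apply/andP; split; last first.
    by rewrite ffunE /= mulnC -divn_eq.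
  apply/forallP => k; rewrite ffunE /= mulnC leq_trunc_div/=.
  by rewrite {1}(divn_eq (q k) L) ltn_add2l ltn_pmod.
apply: (@le_trans _ _ (\sum_(u : T)
    C * L%:R ^+ d.+1 * L%:R `^ (h + eps) * N%:R `^ (1 - p^-1))).
  by apply: ler_sum => u _; exact: bound.
rewrite sumr_const card_prod card_ffun !card_ord -[leLHS]mulr_natr.
rewrite ME !natrM natrX exprMn.
by rewrite le_eqVlt; apply/orP; left; apply/eqP; ring.
Qed.

(** * Pairs of directions at dyadic distances *)

Lemma natr_distE (R : realType) (m n : nat) :
  `|m%:R - n%:R : R| = ((m - n) + (n - m))%N%:R.
Proof.
have [mn|nm] := leqP m n.
  rewrite distrC ger0_norm ?subr_ge0 ?ler_nat// -natrB//; congr (_%:R); lia.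
rewrite ger0_norm ?subr_ge0 ?ler_nat ?(ltnW nm)// -natrB 1?ltnW//; congr (_%:R);
  lia.
Qed.

(** [i] is an entry of largest difference, so the power of two that fits it controls all the
    others. *)
Lemma dyadic_distance (R : realType) (m j : nat)
    (q q' : {ffun 'I_m.+1 -> 'I_(2 ^ j)}) : q != q' ->
  exists (l : 'I_j) (i : 'I_m.+1),
    [/\ ((2 ^ l)%:R : R) <= `|(q' i)%:R - (q i)%:R|,
       `|(q' i)%:R - (q i)%:R| < (2 * (2 ^ l)%:R : R) &
       forall k, `|(q' k)%:R - (q k)%:R| < (2 * (2 ^ l)%:R : R)].
Proof.
move=> qq'.
pose dist (k : 'I_m.+1) := ((q' k - q k) + (q k - q' k))%N.
have [i _ imax] := @arg_maxnP _ ord0 xpredT dist isT.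
have di : (0 < dist i)%N.
  rewrite lt0n; apply: contraNneq qq' => di0; apply/eqP/ffunP => k.
  apply: val_inj => /=; have := imax k isT; rewrite di0 /dist; lia.
have /andP[l1 l2] := trunc_log_bounds (isT : (1 < 2)%N) di.
have lj : (trunc_log 2 (dist i) < j)%N.
  rewrite -(ltn_exp2l _ _ (isT : (1 < 2)%N)) (leq_ltn_trans l1)//.
  by rewrite /dist; have := ltn_ord (q i); have := ltn_ord (q' i); lia.
have dl k : `|(q' k)%:R - (q k)%:R| < (2 * (2 ^ trunc_log 2 (dist i))%:R : R).
  rewrite natr_distE -natrM ltr_nat -expnS.
  exact: leq_ltn_trans (imax k isT) l2.
exists (Ordinal lj), i; split => //=.
by rewrite natr_distE ler_nat.
Qed.

(** [cnt] stands for the number of common cells. Its decay [M / L] cancels the factor [L] of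
    [near_meets_sum], so each of the [j] dyadic distances contributes at most the value at [L = M];
    the diagonal is of lower order. *)
Lemma weighted_pairs (R : realType) (d : nat) (h p lam K eps : R) :
  kakeya_maximal_bound d.+1 h p -> 0 < h -> 1 < p ->
  0 < lam -> 0 < K -> 0 < eps ->
  exists2 C : R, 0 < C & forall (j N : nat) (b : 'I_N -> 'I_d.+2 -> R)
    (al : {ffun 'I_d.+1 -> 'I_(2 ^ j)} -> 'I_N)
    (D : {set {ffun 'I_d.+1 -> 'I_(2 ^ j)}})
    (cnt : {ffun 'I_d.+1 -> 'I_(2 ^ j)} -> {ffun 'I_d.+1 -> 'I_(2 ^ j)} -> R)
    (C1 : R), (0 < N)%N -> 0 <= C1 ->
  (forall q q', q != q' -> ~ near_meet b al lam K q q' -> cnt q q' = 0) ->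
  (forall q, cnt q q <= C1 * (2 ^ j)%:R) ->
  (forall q q' : {ffun 'I_d.+1 -> 'I_(2 ^ j)}, forall k, q k != q' k ->
    cnt q q' <= C1 * (2 ^ j)%:R / `|(q' k)%:R - (q k)%:R|) ->
  \sum_(q in D) \sum_(q' in D) cnt q q' <=
    C * C1 * j.+1%:R * (2 ^ j)%:R ^+ d.+2 * (2 ^ j)%:R `^ (h + eps) *
      N%:R `^ (1 - p^-1).
Proof.
move=> maxbound h0 p1 lam0 K0 eps0; have p0 : 0 < p := lt_trans ltr01 p1.
have [C C0 bound] := near_meets_sum _ _ _ _ _ _ _ maxbound p1 lam0 K0 eps0.
exists (1 + C * d.+1%:R); first by rewrite addr_gt0// mulr_gt0.
move=> j N b al D cnt C1 N0 C10 cnt0 cntd cntk.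
pose dir := {ffun 'I_d.+1 -> 'I_(2 ^ j)}.
set M : R := (2 ^ j)%:R in cntd cntk *.
have M1 : 1 <= M by rewrite /M ler1n expn_gt0.
have M0 : 0 < M by lra.
have he : 0 <= h + eps by lra.
pose W (l : 'I_j) : R := C1 * M / (2 ^ l)%:R.
have L0 (l : 'I_j) : 0 < (2 ^ l)%:R :> R by rewrite ltr0n expn_gt0.
have W0 l : 0 <= W l by rewrite /W divr_ge0// mulr_ge0// ltW.
have pointwise (q q' : dir) : q' \in D -> cnt q q' <= (C1 * M) *+ (q == q') +
    \sum_(l < j) \sum_(i < d.+1)
      (W l) *+ (q' \in near_meets b al lam K D i (2 ^ l) q).
  move=> q'D; have S0 : 0 <= \sum_(l < j) \sum_(i < d.+1)
      (W l) *+ (q' \in near_meets b al lam K D i (2 ^ l) q).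
    by apply: sumr_ge0 => l _; apply: sumr_ge0 => i _; rewrite mulrn_wge0.
  have [qq'|qq'] := eqVneq q q'.
    by rewrite mulr1n -{1}qq' (le_trans (cntd q))// lerDl.
  rewrite mulr0n add0r.
  have [nm|/(cnt0 _ _ qq') ->//] := pselect (near_meet b al lam K q q').
  have [l [i [h1 h2 h3]]] := dyadic_distance R d j q q' qq'.
  rewrite (bigD1 l)//= (bigD1 i)//= -addrA.
  have -> : q' \in near_meets b al lam K D i (2 ^ l) q.
    rewrite inE q'D/=; apply/and4P; split => //; first exact/asboolP.
    exact/forallP.
  rewrite mulr1n; apply: (@le_trans _ _ (W l)); last first.
    rewrite lerDl addr_ge0//; first by apply: sumr_ge0 => k _;
      rewrite mulrn_wge0.
    by apply: sumr_ge0 => l' _; apply: sumr_ge0 => k _; rewrite mulrn_wge0.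
  have qi : q i != q' i.
    by apply: contraTneq h1 => ->; rewrite subrr normr0 -ltNge.
  apply: le_trans (cntk _ _ _ qi) _.
  rewrite /W ler_wpM2l ?mulr_ge0 ?(ltW M0)// lef_pV2 ?posrE//.
  exact: lt_le_trans h1.
apply: (@le_trans _ _ (\sum_(q in D) (C1 * M +
    \sum_(l < j) \sum_(i < d.+1) W l * #|near_meets b al lam K D i (2 ^ l)
      q|%:R))).
  apply: ler_sum => q qD; apply: le_trans (ler_sum _ (fun q' => pointwise q q'))
    _.
  rewrite big_split/= lerD//.
    rewrite (bigD1 q)//= eqxx mulr1n big1 ?addr0// => q' /andP[_ qq'].
    by rewrite eq_sym (negbTE qq').
  rewrite exchange_big/=; apply: ler_sum => l _.
  rewrite exchange_big/=; apply: ler_sum => i _.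
  rewrite (eq_bigr (fun q' => if q' \in near_meets b al lam K D i (2 ^ l) q
    then W l else 0)); last by move=> q' _; case: ifP.
  rewrite -big_mkcondr sumr_const -[leLHS]mulr_natr ler_wpM2l// ler_nat.
  by apply/subset_leq_card/fintype.subsetP => q' /andP[].
rewrite big_split/= sumr_const.
set E := M ^+ d.+2 * M `^ (h + eps) * N%:R `^ (1 - p^-1).
have N1 : 1 <= N%:R `^ (1 - p^-1) :> R.
  rewrite -[leLHS](powRr0 (N%:R : R)) ler_powR ?ler1n// subr_ge0 invf_le1
    ?ltW//.
have Mh1 : 1 <= M `^ (h + eps) by rewrite -[leLHS](powRr0 M) ler_powR.
have part1 : (C1 * M) *+ #|D| <= C1 * E.
  rewrite -mulr_natr -mulrA ler_wpM2l// /E.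
  apply: (@le_trans _ _ (M ^+ d.+2)).
    rewrite exprS ler_pM2l// -natrX ler_nat; apply: leq_trans (max_card _) _.
    by rewrite card_ffun !card_ord.
  by rewrite -mulrA ler_peMr ?exprn_ge0 ?(ltW M0)// mulr_ege1.
have part2 : \sum_(q in D) \sum_(l < j) \sum_(i < d.+1)
    W l * #|near_meets b al lam K D i (2 ^ l) q|%:R <= j%:R * d.+1%:R * (C * C1
      * E).
  rewrite exchange_big/=.
  apply: (@le_trans _ _ (\sum_(l < j) \sum_(i < d.+1) C * C1 * E)); last first.
    by rewrite !sumr_const !card_ord -[_ *+ j]mulr_natl -[_ *+ d.+1]mulr_natl
      mulrA.
  apply: ler_sum => l _; rewrite exchange_big/=; apply: ler_sum => i _.
  rewrite -mulr_sumr.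
  have ME : (2 ^ j = 2 ^ (j - l) * 2 ^ l)%N by rewrite -expnD subnK// ltnW.
  have l20 : (0 < 2 ^ l)%N by rewrite expn_gt0.
  apply: le_trans (ler_wpM2l (W0 l) (bound _ _ b al D i _ _ l20 N0 ME)) _.
  rewrite -/M /W /E.
  set L : R := (2 ^ l)%:R.
  have LM : L <= M by rewrite ler_nat leq_exp2l// ltnW.
  have -> : C1 * M / L * (C * M ^+ d.+1 * L * L `^ (h + eps) * N%:R `^ (1 -
    p^-1)) =
     C * C1 * (M ^+ d.+2 * L `^ (h + eps) * N%:R `^ (1 - p^-1)).
    by rewrite [M ^+ d.+2]exprS; field; rewrite gt_eqF// L0.
  rewrite ler_wpM2l ?mulr_ge0 ?(ltW C0)// ler_wpM2r ?powR_ge0// ler_wpM2l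
    ?exprn_ge0 ?(ltW M0)//.
  by rewrite ge0_ler_powR// nnegrE ltW// L0.
apply: le_trans (lerD part1 part2) _.
have E0 : 0 <= E.
  apply: mulr_ge0; last exact: powR_ge0.
  by apply: mulr_ge0; [apply: exprn_ge0; exact: ltW|exact: powR_ge0].
rewrite [leRHS](_ : _ = (1 + C * d.+1%:R) * (C1 * E) * j.+1%:R);
  last by rewrite /E; ring.
have CE : 0 <= C1 * E by rewrite mulr_ge0.
have -> : C1 * E + j%:R * d.+1%:R * (C * C1 * E) = (C1 * E) * (1 + C * d.+1%:R *
  j%:R) by ring.
rewrite [leRHS](_ : _ = (C1 * E) * ((1 + C * d.+1%:R) * j.+1%:R)); last by ring.
rewrite ler_wpM2l// -natr1.
have j0 : 0 <= j%:R :> R by [].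
have Cd : 0 <= C * d.+1%:R by rewrite mulr_ge0// ltW.
nra.
Qed.

(** * Incidences of cells and tubes *)

Section lattice_points.
Context {R : realType}.

(** Codes the integers of [[z, z + w]] injectively by natural numbers below [truncn w + 2]. *)
Definition int_index (z : R) (x : int) : nat := `|x - Num.floor z|%N.

Lemma int_index_lt (z w : R) (x : int) : z <= x%:~R -> x%:~R <= z + w ->
  (int_index z x < (Num.truncn w).+2)%N.
Proof.
move=> zx xw; have w0 : 0 <= w by rewrite -(lerD2l z) addr0 (le_trans zx).
have fx : Num.floor z <= x by rewrite -(ler_int R) (le_trans (floor_le z)).
have [/andP[_ zf] /andP[_ wt]] := (floor_itv z, truncn_itv w0).
rewrite -(ltr_nat R) /int_index natr_absz ger0_norm ?subr_ge0// intrB.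
by move: zf; rewrite intrD -[_.+2%:R]natr1; lra.
Qed.

Lemma int_index_inj (z : R) (x y : int) : z <= x%:~R -> z <= y%:~R ->
  int_index z x = int_index z y -> x = y.
Proof.
move=> zx zy; have fx : Num.floor z <= x by rewrite -(ler_int R) (le_trans
  (floor_le z)).
have fy : Num.floor z <= y by rewrite -(ler_int R) (le_trans (floor_le z)).
rewrite /int_index; lia.
Qed.

(** The centre [Y] of the other coordinates depends on the first one because the points are counted
    along a slanted line. *)
Lemma size_lattice_le (d : nat) (S : seq {ffun 'I_d.+2 -> int}) (X w r : R)
    (Y : int -> 'I_d.+1 -> R) : uniq S -> 0 <= w -> 0 <= r ->
  (forall c : {ffun 'I_d.+2 -> int}, c \in S -> `|(c ord0)%:~R - X| <= w /\
    forall k, `|(c (lift ord0 k))%:~R - Y (c ord0) k| <= r) ->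
  (size S)%:R <= (2 * w + 2) * (2 * r + 2) ^+ d.+1.
Proof.
move=> uS w0 r0 SH.
pose F (c : {ffun 'I_d.+2 -> int}) :
    'I_(Num.truncn (2 * w)).+2 * {ffun 'I_d.+1 -> 'I_(Num.truncn (2 * r)).+2} :=
  (inord (int_index (X - w) (c ord0)),
   [ffun k => inord (int_index (Y (c ord0) k - r) (c (lift ord0 k)))]).
have bd (z u v : R) : `|z - u| <= v -> u - v <= z /\ z <= u - v + 2 * v.
  by rewrite ler_norml => /andP[? ?]; split; lra.
have Finj : {in S &, injective F}.
  move=> c c' cS c'S [] /(congr1 val) /=.
  have [c0 ck] := SH c cS; have [c'0 c'k] := SH c' c'S.
  have [[? ?] [? ?]] := (bd _ _ _ c0, bd _ _ _ c'0).
  rewrite !inordK ?int_index_lt// => /int_index_inj E0 /ffunP Ek.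
  have {}E0 : c ord0 = c' ord0 by exact: E0.
  apply/ffunP => i; case: (unliftP ord0 i) => [k|] ->//.
  have := Ek k; rewrite !ffunE => /(congr1 val) /=.
  have [[? ?] [? ?]] := (bd _ _ _ (ck k), bd _ _ _ (c'k k)).
  rewrite !inordK ?int_index_lt// E0 => /int_index_inj; apply => //.
  by rewrite -E0.
have := uniq_leq_size (_ : uniq (map F S)) (_ : {subset map F S <= enum predT}).
rewrite map_inj_in_uniq// => /(_ uS); rewrite size_map -cardE => H.
have {H} : (size S <= #|{: 'I_(Num.truncn (2 * w)).+2 *
  {ffun 'I_d.+1 -> 'I_(Num.truncn (2 * r)).+2}}|)%N.
  by apply: H => x _; rewrite mem_enum.
rewrite card_prod card_ffun !card_ord -(ler_nat R) natrM natrX => /le_trans;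
  apply.
have tr (u : R) : 0 <= u -> (Num.truncn (2 * u)).+2%:R <= 2 * u + 2.
  move=> u0; have u20 : 0 <= 2 * u by rewrite mulr_ge0.
  have /andP[? _] := truncn_itv u20.
  by rewrite -[_.+2%:R]natr1 -natr1; lra.
by rewrite ler_pM ?exprn_ge0 ?lerXn2r ?nnegrE ?tr// addr_ge0// mulr_ge0.
Qed.

End lattice_points.

(** The sum of the squares [(n * x i - I) ^+ 2] is nonnegative, and expands to [n] times the
    difference of the two sides. *)
Lemma cauchy_schwarz_seq (R : realFieldType) (T : Type) (s : seq T) (x :
  T -> R) :
  (\sum_(i <- s) x i) ^+ 2 <= (size s)%:R * \sum_(i <- s) x i ^+ 2.
Proof.
have [/size0nil->|s0] := posnP (size s); first by rewrite !big_nil mulr0 expr2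
  mulr0.
have n0 : 0 < (size s)%:R :> R by rewrite ltr0n.
set n : R := (size s)%:R in n0 *; set I := \sum_(i <- s) x i.
have : 0 <= \sum_(i <- s) (n * x i - I) ^+ 2 by apply: sumr_ge0 => i _; exact:
  sqr_ge0.
have -> : \sum_(i <- s) (n * x i - I) ^+ 2 =
    n ^+ 2 * (\sum_(i <- s) x i ^+ 2) - n * I ^+ 2.
  transitivity (\sum_(i <- s) (n ^+ 2 * x i ^+ 2 - 2 * n * I * x i + I ^+ 2)).
    by apply: eq_bigr => i _; ring.
  rewrite big_split/= [X in _ + X]big_const_seq count_predT iter_addr_0.
  rewrite sumrB -!mulr_sumr -/I -[I ^+ 2 *+ _]mulr_natl -/n.
  by ring.
by rewrite expr2 -mulrA -mulrBr pmulr_rge0// subr_ge0.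
Qed.

Section cells.
Context {R : realType} {d M N : nat}.
Local Notation dir := {ffun 'I_d.+1 -> 'I_M}.
Local Notation cell := {ffun 'I_d.+2 -> int}.
Variables (b : 'I_N -> 'I_d.+2 -> R) (al : dir -> 'I_N) (lam K : R).
Hypotheses (M0 : (0 < M)%N) (K1 : 1 <= K) (lam0 : 0 < lam).

(* Cells and points are compared after dilation by [M]. *)
Definition near_cell (q : dir) (c : cell) : Prop := exists s : R,
  [/\ lam <= s <= 1, `|M%:R * (b (al q) ord0 + s) - (c ord0)%:~R| <= K &
  forall k, `|M%:R * b (al q) (lift ord0 k) + s * (q k)%:R
              - (c (lift ord0 k))%:~R| <= K].

Lemma near_cell_meet (q q' : dir) (c : cell) :
  near_cell q c -> near_cell q' c -> near_meet b al lam (2 * K) q q'.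
Proof.
have K1' := K1; move=> [t [t1 h0 hk]] [s [/andP[s1 _] h0' hk']]; exists s, t;
  split => //.
  rewrite ler_pdivlMr ?ltr0n// mulrC -[X in X * _](@ger0_norm R)// -normrM.
  rewrite [M%:R * _](_ : _ = (M%:R * (b (al q') ord0 + s) - (c ord0)%:~R) -
    (M%:R * (b (al q) ord0 + t) - (c ord0)%:~R)); last by ring.
  by apply: le_trans (ler_normB _ _) _; lra.
move=> k; rewrite ler_pdivlMr ?ltr0n// mulrC -[X in X * _](@ger0_norm R)//
  -normrM.
have Mn0 : M%:R != 0 :> R by rewrite pnatr_eq0 -lt0n.
rewrite [M%:R * _](_ : _ = (M%:R * b (al q') (lift ord0 k) + s * (q' k)%:R
              - (c (lift ord0 k))%:~R) - (M%:R * b (al q) (lift ord0 k) + t * (q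
                k)%:R
              - (c (lift ord0 k))%:~R)); last by field.
have := hk k; have := hk' k.
by move=> ? ?; apply: le_trans (ler_normB _ _) _; lra.
Qed.

(** Height of the dilated line of direction [q] at first coordinate [c0], the parameter [s] being
    eliminated. *)
Let Y (q : dir) (c0 : int) (k : 'I_d.+1) : R :=
  M%:R * b (al q) (lift ord0 k) + (c0%:~R - M%:R * b (al q) ord0) * ((q k)%:R /
    M%:R).

Let near_cell_slope (q : dir) (c : cell) : near_cell q c ->
  forall k, `|(c (lift ord0 k))%:~R - Y q (c ord0) k| <= 2 * K.
Proof.
have K1' := K1; move=> [s [_ h0 hk]] k.
have M0r : 0 < M%:R :> R by rewrite ltr0n.
have qM : `|(q k)%:R / M%:R : R| <= 1.
  by rewrite ger0_norm ?divr_ge0// ler_pdivrMr// mul1r ler_nat ltnW.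
have -> : (c (lift ord0 k))%:~R - Y q (c ord0) k =
  ((q k)%:R / M%:R) * (M%:R * (b (al q) ord0 + s) - (c ord0)%:~R) -
  (M%:R * b (al q) (lift ord0 k) + s * (q k)%:R - (c (lift ord0 k))%:~R).
  by rewrite /Y; field; rewrite gt_eqF.
apply: le_trans (ler_normB _ _) _; rewrite normrM.
have h : `|(q k)%:R / M%:R| * `|M%:R * (b (al q) ord0 + s) - (c ord0)%:~R| <= 1
  * K.
  by rewrite ler_pM.
have := hk k; lra.
Qed.

Lemma size_near_cell (q : dir) (S : seq cell) : uniq S ->
  (forall c, c \in S -> near_cell q c) ->
  (size S)%:R <= 12 * K * (4 * K + 2) ^+ d.+1 * M%:R.
Proof.
have K1' := K1; have lam0' := lam0; move=> uS SH; have M1 :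
  1 <= M%:R :> R by rewrite ler1n.
apply: (@le_trans _ _ ((2 * (M%:R + K) + 2) * (2 * (2 * K) + 2) ^+ d.+1)).
  have w0 : 0 <= M%:R + K by lra.
  have r0 : 0 <= 2 * K by lra.
  apply: (size_lattice_le _ _ (M%:R * b (al q) ord0) _ _ (Y q) uS w0 r0).
  move=> c /SH cq; split; last exact: near_cell_slope.
  have [s [/andP[s0 s1] h0 _]] := cq; move: h0; rewrite !ler_norml => /andP[h1
    h2].
  have h3 : 0 <= M%:R * s by rewrite mulr_ge0//; lra.
  have h4 : M%:R * s <= M%:R by rewrite ler_piMr.
  by apply/andP; split; lra.
rewrite (_ : 2 * (2 * K) = 4 * K); last by ring.
rewrite [leRHS]mulrAC ler_wpM2r ?exprn_ge0//; [lra|nra].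
Qed.

(** [X] is the first coordinate at which the two dilated lines agree in entry [k]. Their slopes
    differ by [rho / M] there, so a cell near both has its first coordinate within [4 * K * M / rho]
    of [X]; each such coordinate leaves boundedly many cells along the first line. *)
Lemma size_near_cells (q q' : dir) (k : 'I_d.+1) (S : seq cell) : uniq S ->
  q k != q' k ->
  (forall c, c \in S -> near_cell q c /\ near_cell q' c) ->
  (size S)%:R <= 12 * K * (4 * K + 2) ^+ d.+1 * M%:R / `|(q' k)%:R - (q k)%:R|.
Proof.
have K1' := K1; move=> uS qq' SH; have M1 : 1 <= M%:R :> R by rewrite ler1n.
set rho : R := `|_|; have rho1 : 1 <= rho.
  by rewrite /rho natr_dist_ge1// eq_sym.
have qM (r : dir) : (0 : R) <= (r k)%:R <= (M%:R : R) by rewrite ler0n ler_nat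
  ltnW.
have rhoM : rho <= M%:R.
  rewrite /rho ler_norml; move: (qM q) (qM q') => /andP[? ?] /andP[? ?].
  by apply/andP; split; lra.
have rho0 : 0 < rho by lra.
have Mrho : 1 <= M%:R / rho by rewrite ler_pdivlMr ?mul1r.
pose X : R := (M%:R ^+ 2 * (b (al q') (lift ord0 k) - b (al q) (lift ord0 k)) +
  M%:R * b (al q) ord0 * (q k)%:R - M%:R * b (al q') ord0 * (q' k)%:R) /
  ((q k)%:R - (q' k)%:R).
apply: (@le_trans _ _ ((2 * (4 * K * (M%:R / rho)) + 2) * (2 * (2 * K) + 2) ^+
  d.+1)).
  have w0 : 0 <= 4 * K * (M%:R / rho) by nra.
  have r0 : 0 <= 2 * K by lra.
  apply: (size_lattice_le _ _ X _ _ (Y q) uS w0 r0).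
  move=> c /SH[cq cq']; split; last exact: near_cell_slope.
  have [s [_ h0 /(_ k) hk]] := cq; have [t [_ h0' /(_ k) hk']] := cq'.
  have dq : (q k)%:R - (q' k)%:R != 0 :> R.
    by rewrite subr_eq0 eqr_nat; apply: contra qq' => /eqP e; apply/eqP/val_inj.
  set e0 := M%:R * _ - _ in h0; set ek := _ - _ in hk.
  set e0' := M%:R * _ - _ in h0'; set ek' := _ - _ in hk'.
  have -> : (c ord0)%:~R - X = (M%:R * ek - M%:R * ek' - (q k)%:R * e0 + (q'
    k)%:R * e0')
      / ((q k)%:R - (q' k)%:R).
    by rewrite /X /e0 /ek /e0' /ek'; field.
  rewrite normrM normfV distrC -/rho mulrA ler_wpM2r ?invr_ge0 ?(ltW rho0)//.
  have MK (u v : R) : 0 <= u <= M%:R -> `|v| <= K -> `|u * v| <= M%:R * K.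
    by move=> /andP[u0 u1] vK; rewrite normrM (ger0_norm u0) ler_pM.
  have MM : (0 : R) <= (M%:R : R) <= (M%:R : R) by rewrite ler0n lexx.
  move: (MK _ _ MM hk) (MK _ _ MM hk') (MK _ _ (qM q) h0) (MK _ _ (qM q') h0').
  rewrite !ler_norml => /andP[u1 v1] /andP[u2 v2] /andP[u3 v3] /andP[u4 v4].
  by apply/andP; split; clear -u1 v1 u2 v2 u3 v3 u4 v4; lra.
rewrite (_ : 2 * (2 * K) = 4 * K); last by ring.
rewrite [leRHS](_ : _ = 12 * K * (M%:R / rho) * (4 * K + 2) ^+ d.+1);
  last by ring.
rewrite ler_wpM2r ?exprn_ge0//; [lra|nra].
Qed.

End cells.

(** The second moment of the multiplicity of a cell is the sum, over ordered pairs of directions, of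
    the number of common cells, and [size_near_cell] and [size_near_cells] are the bounds that
    [weighted_pairs] asks for. *)
Lemma incidence_bound (R : realType) (d : nat) (h p lam K eps : R) :
  kakeya_maximal_bound d.+1 h p -> 0 < h -> 1 < p ->
  0 < lam -> 1 <= K -> 0 < eps ->
  exists2 C : R, 0 < C & forall (j N : nat) (b : 'I_N -> 'I_d.+2 -> R)
    (al : {ffun 'I_d.+1 -> 'I_(2 ^ j)} -> 'I_N)
    (D : {set {ffun 'I_d.+1 -> 'I_(2 ^ j)}}) (B : seq {ffun 'I_d.+2 -> int})
    (nu : R), (0 < N)%N -> uniq B -> 0 <= nu ->
  (forall q, q \in D -> nu <= (count (fun c => `[< near_cell b al lam K q c >])
    B)%:R) ->
  (#|D|%:R * nu) ^+ 2 <= (size B)%:R *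
    (C * j.+1%:R * (2 ^ j)%:R ^+ d.+2 * (2 ^ j)%:R `^ (h + eps) *
      N%:R `^ (1 - p^-1)).
Proof.
move=> maxbound h0 p1 lam0 K1 eps0.
have K20 : 0 < 2 * K by lra.
have [C C0 bound] := weighted_pairs _ _ _ _ _ _ _ maxbound h0 p1 lam0 K20 eps0.
pose C1 : R := 12 * K * (4 * K + 2) ^+ d.+1.
have C10 : 0 < C1 by rewrite /C1 !mulr_gt0 ?exprn_gt0//; lra.
exists (C * C1); first exact: mulr_gt0.
move=> j N b al D B nu N0 uB nu0 nuB.
have M0 : (0 < 2 ^ j)%N by rewrite expn_gt0.
pose dir := {ffun 'I_d.+1 -> 'I_(2 ^ j)}.
pose near (q : dir) (c : {ffun 'I_d.+2 -> int}) := `[< near_cell b al lam K q c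
  >].
pose cnt (q q' : dir) : R := (count (fun c => near q c && near q' c) B)%:R.
pose mult c : R := \sum_(q in D) (near q c)%:R.
have total : #|D|%:R * nu <= \sum_(c <- B) mult c.
  rewrite /mult exchange_big/= mulr_natl -sumr_const; apply:
    ler_sum => q /nuB/le_trans; apply.
  by rewrite -natr_sum ler_nat -sum1_count big_mkcond/=; apply: leq_sum => c _;
    rewrite -/(near q c); case: (near q c).
have D0 : 0 <= #|D|%:R * nu by rewrite mulr_ge0.
apply: (@le_trans _ _ ((\sum_(c <- B) mult c) ^+ 2)).
  by rewrite lerXn2r ?nnegrE// (le_trans D0).
apply: le_trans (cauchy_schwarz_seq _ _ _ _) _; rewrite ler_wpM2l//.
have -> : \sum_(c <- B) mult c ^+ 2 = \sum_(q in D) \sum_(q' in D) cnt q q'.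
  transitivity (\sum_(c <- B) \sum_(q in D) \sum_(q' in D) ((near q c && near q'
    c)%:R : R)).
    apply: eq_bigr => c _; rewrite expr2 /mult mulr_suml; apply: eq_bigr => q _.
    by rewrite mulr_sumr; apply: eq_bigr => q' _; rewrite -natrM mulnb.
  rewrite exchange_big/=; apply: eq_bigr => q _.
  rewrite exchange_big/=; apply: eq_bigr => q' _.
  rewrite /cnt -sum1_count natr_sum [RHS]big_mkcond/=.
  by apply: eq_bigr => c _; case: ifP.
have ufilter (P : pred {ffun 'I_d.+2 -> int}) : uniq [seq c <- B | P c] by
  exact: filter_uniq.
apply: bound => //; first exact: ltW.
- move=> q q' _ nm; rewrite /cnt (eq_count (a2 := pred0)) ?count_pred0// => c.
  apply/negP => /andP[/asboolP nq /asboolP nq']; apply: nm.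
  exact: near_cell_meet nq nq'.
- move=> q; rewrite /cnt -size_filter.
  apply: (size_near_cell b al lam K M0 K1 lam0 q _ (ufilter _)) => c.
  by rewrite mem_filter => /andP[/andP[/asboolP]].
- move=> q q' k qq'; rewrite /cnt -size_filter.
  apply: (size_near_cells b al lam K M0 K1 q q' k _ (ufilter _) qq') => c.
  by rewrite mem_filter => /andP[/andP[/asboolP ? /asboolP ?] _].
Qed.

(** * Covers at dyadic scales *)

Section fat_cells.
Context {R : realType} {n : nat}.
Implicit Types (U : set 'rV[R]_n) (c : {ffun 'I_n -> int}).

(** Radius 2 lets one cell contain any set of diameter at most [2 ^ -j]: seen from the floors of one
    of its points, the dilated set has coordinates in [[-1, 2)]. The strict inequality makes the
    cell open, for use with compactness. *)
Definition fat_cell (j : nat) c : set 'rV[R]_n :=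
  [set x | forall k, `|(2 ^ j)%:R * x ord0 k - (c k)%:~R| < 2].

Lemma open_fat_cell j c : open (fat_cell j c).
Proof.
rewrite openE => x xc.
have ff := @filter_forall _ 'I_n
  (fun k => [set y : 'rV[R]_n | `|(2 ^ j)%:R * y ord0 k - (c k)%:~R| < 2]) (nbhs
    x).
apply: ff => k.
pose f (y : 'rV[R]_n) : R := `|(2 ^ j)%:R * y ord0 k - (c k)%:~R|.
have cf : {for x, continuous f}.
  apply: continuous_comp; last exact: norm_continuous.
  apply: continuousB; last exact: cst_continuous.
  by apply: continuousM; [exact: cst_continuous|exact: coord_continuous].
apply: (cf [set r | r < 2]); apply: open_nbhs_nbhs; split; last exact: xc.
exact: open_lt.
Qed.

Lemma diam_ge U (x y : 'rV[R]_n) : U x -> U y -> ((enorm (x - y))%:E <= diam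
  U)%E.
Proof. by move=> Ux Uy; apply: ereal_sup_ubound; exists x => //; exists y. Qed.

Lemma sub_fat_cell U j : U !=set0 -> (diam U <= ((2 ^ j)%:R^-1)%:E)%E ->
  exists c, U `<=` fat_cell j c.
Proof.
move=> [x Ux] dU; have M0 : 0 < (2 ^ j)%:R :> R by rewrite ltr0n expn_gt0.
exists [ffun k => Num.floor ((2 ^ j)%:R * x ord0 k)] => y Uy k.
rewrite ffunE; have /andP[f1 f2] := floor_itv ((2 ^ j)%:R * x ord0 k).
have : `|(y - x) ord0 k| <= (2 ^ j)%:R^-1.
  apply: le_trans (coord_le_enorm _ _) _.
  by rewrite -lee_fin; apply: le_trans (diam_ge _ _ _ Uy Ux) dU.
rewrite !mxE -(ler_pM2l M0) mulfV ?gt_eqF// -{1}(gtr0_norm M0) -normrM mulrBr.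
move: f2; rewrite intrD ler_norml ltr_norml => f2 /andP[h1 h2].
by apply/andP; split; lra.
Qed.

Lemma dyadic_scale (x : R) : 0 < x <= 1 ->
  exists j : nat, x <= (2 ^ j)%:R^-1 < 2 * x.
Proof.
move=> /andP[x0 x1]; have xV1 : 1 <= x^-1 by rewrite invf_ge1.
have xV0 : 0 <= x^-1 by lra.
have t0 : (0 < Num.truncn x^-1)%N by rewrite truncn_gt0.
have /andP[l1 l2] := trunc_log_bounds (isT : (1 < 2)%N) t0.
have /andP[t1 t2] := truncn_itv xV0.
set j := trunc_log 2 _ in l1 l2; exists j.
have M0 : 0 < (2 ^ j)%:R :> R by rewrite ltr0n expn_gt0.
apply/andP; split.
  rewrite -[x]invrK lef_pV2 ?posrE ?invr_gt0//.
  by apply: le_trans t1; rewrite ler_nat.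
have -> : 2 * x = (2^-1 * x^-1)^-1 by rewrite invfM !invrK.
rewrite ltf_pV2 ?posrE ?mulr_gt0 ?invr_gt0//.
rewrite ltr_pdivrMl//; apply: lt_le_trans t2 _.
by rewrite -natrM -expnS ler_nat.
Qed.

(** A set of diameter 0 singles out no scale, so the diameter is raised to a positive [x] at a cost
    of at most [tau]. Rounding [x] to a power of two costs the factor [2 ^ beta]. *)
Lemma fat_cell_of_set (U : set 'rV[R]_n) (s0 beta tau : R) (j0 : nat) :
  U !=set0 -> (diam U <= ((2 ^ j0)%:R^-1)%:E)%E -> 0 <= s0 <= beta -> 0 < beta
    ->
  0 < tau ->
  exists jc : nat * {ffun 'I_n -> int}, [/\ (j0 <= jc.1)%N,
    U `<=` fat_cell jc.1 jc.2 &
    (((2 ^ jc.1)%:R^-1 `^ beta)%:E <= (2 `^ beta)%:E * (diam_pow s0 U +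
      tau%:E))%E].
Proof.
move=> U0 dU /andP[s00 s0b] b0 tau0.
have M0 j : 0 < (2 ^ j)%:R :> R by rewrite ltr0n expn_gt0.
have dU0 : (0 <= diam U)%E.
  case: U0 => x Ux; apply: le_trans (diam_ge _ _ _ Ux Ux).
  by rewrite lee_fin; exact: sqrtr_ge0.
have dUfin : diam U \is a fin_num.
  by rewrite ge0_fin_numE// (le_lt_trans dU) ?ltry.
have dpow : diam_pow s0 U = (fine (diam U) `^ s0)%:E.
  rewrite /diam_pow ifF; last by apply/negbTE/set0P.
  by rewrite -[in LHS](fineK dUfin) poweR_EFin.
move: dU dU0; rewrite -(fineK dUfin) lee_fin => dU; rewrite lee_fin => dU0.
rewrite dpow; set D := fine (diam U) in dU dU0 *.
pose x : R := Num.max D (Num.min (tau `^ beta^-1) (2 ^ j0)%:R^-1).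
have xle : x <= (2 ^ j0)%:R^-1 by rewrite /x ge_max dU/= ge_min lexx orbT.
have x0 : 0 < x.
  by rewrite /x lt_max; apply/orP; right; rewrite lt_min powR_gt0// invr_gt0 M0.
have j01 : (2 ^ j0)%:R^-1 <= 1 :> R by rewrite invf_le1// ler1n expn_gt0.
have x01 : 0 < x <= 1 by rewrite x0 (le_trans xle).
have [j /andP[xj jx]] := dyadic_scale _ x01.
have [c Uc] : exists c, U `<=` fat_cell j c.
  apply: sub_fat_cell => //; rewrite -(fineK dUfin) lee_fin.
  by apply: le_trans xj; rewrite /x le_max lexx.
exists (j, c); split => //=.
  have : (2 ^ j)%:R^-1 < 2 * (2 ^ j0)%:R^-1 :> R.
    by apply: lt_le_trans jx _; rewrite ler_pM2l.
  rewrite -[ltLHS]div1r ltr_pdivrMr// mulrAC ltr_pdivlMr// mul1r -natrM -expnS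
    ltr_nat.
  by rewrite ltn_exp2l// ltnS.
rewrite lee_fin; apply: (@le_trans _ _ ((2 * x) `^ beta)).
  by rewrite ge0_ler_powR ?(ltW b0)// ?nnegrE ?invr_ge0 ?mulr_ge0// ltW.
rewrite powRM ?(ltW x0)// ler_pM2l ?powR_gt0//.
have Dpow : D `^ beta <= D `^ s0.
  have [->|D0] := eqVneq D 0.
    by rewrite powR0 ?gt_eqF// powR_ge0.
  by rewrite ger_powR// lt0r D0 dU0 (le_trans dU).
have taupow : (Num.min (tau `^ beta^-1) (2 ^ j0)%:R^-1) `^ beta <= tau.
  apply: (@le_trans _ _ ((tau `^ beta^-1) `^ beta)).
    rewrite ge0_ler_powR ?(ltW b0)// ?nnegrE ?powR_ge0// ?ge_min ?lexx//.
    by rewrite le_min powR_ge0 invr_ge0 ltW.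
  by rewrite -powRrM mulVf ?gt_eqF// powRr1// ltW.
rewrite /x; case: (leP D) => _.
  by apply: le_trans taupow _; rewrite lerDr powR_ge0.
by apply: le_trans Dpow _; rewrite lerDl ltW.
Qed.

End fat_cells.

Lemma sum_undup_le (R : numDomainType) (T : eqType) (s : seq T) (f : T -> R) :
  (forall i, 0 <= f i) -> \sum_(i <- undup s) f i <= \sum_(i <- s) f i.
Proof.
move=> f0; elim: s => [|x s IH]; first by rewrite !big_nil.
rewrite /= big_cons; case: ifP => _; last by rewrite big_cons lerD2l.
by apply: le_trans IH _; rewrite lerDr.
Qed.

(** Passing from the covering sets to open fat cells lets compactness extract a finite list; the
    terms [tau] are taken geometric so that their total stays bounded. *)
Lemma hausdorff_null_cells (R : realType) (n : nat) (A : set 'rV[R]_n)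
    (s0 beta eta : R) (j0 : nat) :
  compact A -> hausdorff_measure s0 A = 0%E -> 0 <= s0 <= beta -> 0 < beta ->
  0 < eta ->
  exists F : seq (nat * {ffun 'I_n -> int}),
    [/\ uniq F, forall jc, jc \in F -> (j0 <= jc.1)%N,
      A `<=` [set x | exists2 jc, jc \in F & fat_cell jc.1 jc.2 x] &
      \sum_(jc <- F) (2 ^ jc.1)%:R^-1 `^ beta <= eta].
Proof.
move=> cA HA s0b b0 eta0.
have M0 j : 0 < (2 ^ j)%:R :> R by rewrite ltr0n expn_gt0.
(* One [e1] pays for the powers of the diameters and one for the geometric errors, both multiplied
   by [2 ^ beta]. *)
pose e1 : R := eta / (2 * 2 `^ beta).
have e10 : 0 < e1 by rewrite divr_gt0// mulr_gt0// powR_gt0.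
have : (hausdorff_content s0 ((2 ^ j0)%:R^-1) A < e1%:E)%E.
  apply: (@le_lt_trans _ _ (hausdorff_measure s0 A));
    last by rewrite HA lte_fin.
  apply: ereal_sup_ubound; exists (2 ^ j0)%:R^-1 => //.
  by rewrite /= in_itv/= andbT invr_gt0.
move=> /ereal_inf_lt [_ [U [AU dU] <-] Usum].
have tau0 k : 0 < e1 / 2 ^+ k.+1 by rewrite divr_gt0// exprn_gt0.
have cell k : exists jc : nat * {ffun 'I_n -> int}, U k !=set0 -> [/\ (j0 <=
  jc.1)%N,
    U k `<=` fat_cell jc.1 jc.2 &
    (((2 ^ jc.1)%:R^-1 `^ beta)%:E <=
      (2 `^ beta)%:E * (diam_pow s0 (U k) + (e1 / 2 ^+ k.+1)%:E))%E].
  (* An empty set receives an arbitrary cell; the subcover is drawn from the nonempty sets only. *)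
  have [Uk|Uk] := pselect (U k !=set0); last by exists (0%N, [ffun => 0]).
  have [jc H] := fat_cell_of_set _ _ _ _ j0 Uk (dU k) s0b b0 (tau0 k).
  by exists jc.
pose jc k := projT1 (cid (cell k)).
have jcP k : U k !=set0 -> [/\ (j0 <= (jc k).1)%N,
    U k `<=` fat_cell (jc k).1 (jc k).2 &
    (((2 ^ (jc k).1)%:R^-1 `^ beta)%:E <=
      (2 `^ beta)%:E * (diam_pow s0 (U k) + (e1 / 2 ^+ k.+1)%:E))%E].
  by rewrite /jc; case: (cid _).
have [D [DU DA]] : exists D : seq nat, (forall k, k \in D -> U k !=set0) /\
    forall x, A x -> exists2 k, k \in D & fat_cell (jc k).1 (jc k).2 x.
  move: cA; rewrite compact_cover => /(_ nat [set k | U k !=set0]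
    (fun k => fat_cell (jc k).1 (jc k).2)) [].
  - by move=> k _; exact: open_fat_cell.
  - move=> x /AU [k _ Ukx]; exists k; first by exists x.
    by have [_ + _] := jcP k (ex_intro _ x Ukx); apply.
  - move=> D DU DA; exists (finmap.enum_fset D); split.
      by move=> k /DU /set_mem.
    by move=> x /DA [k kD kx]; exists k.
have [m Dm] : exists m, forall k, k \in D -> (k < m)%N.
  exists (\max_(k <- D) k).+1 => k kD; rewrite ltnS.
  by rewrite (@leq_bigmax_seq _ _ xpredT id).
exists (undup [seq jc k | k <- iota 0 m & k \in D]); split.
- exact: undup_uniq.
- move=> u; rewrite mem_undup => /mapP[k]; rewrite mem_filter => /andP[kD _] ->.
  by have [] := jcP k (DU _ kD).
- move=> x /DA [k kD kx]; exists (jc k) => //.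
  rewrite mem_undup; apply/mapP; exists k => //.
  by rewrite mem_filter kD mem_iota/= add0n Dm.
apply: le_trans (sum_undup_le _ _ _ _ _) _; first by move=> u; exact: powR_ge0.
rewrite big_map big_filter big_mkcond/= -{1}[m]subn0 big_mkord.
rewrite -lee_fin -sumEFin.
apply: (@le_trans _ _ (\sum_(k < m) (2 `^ beta)%:E *
    (diam_pow s0 (U k) + (e1 / 2 ^+ k.+1)%:E))%E).
  apply: lee_sum => k _; case: ifP => [kD|_].
    by have [] := jcP k (DU _ kD).
  rewrite mule_ge0 ?lee_fin ?powR_ge0// adde_ge0//.
    by rewrite /diam_pow; case: ifP => // _; exact: poweR_ge0.
  by rewrite lee_fin ltW.
have dp0 k : (0 <= diam_pow s0 (U k))%E by rewrite /diam_pow; case: ifP => // _;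
  exact: poweR_ge0.
rewrite -ge0_sume_distrr; last by move=> k _; rewrite adde_ge0// lee_fin ltW.
rewrite big_split/=.
have le1 : (\sum_(k < m) diam_pow s0 (U k) <= e1%:E)%E.
  apply: le_trans (ltW Usum).
  have := @nneseries_lim_ge R (fun k => diam_pow s0 (U k)) xpredT 0 m (fun k _ _
    => dp0 k).
  by rewrite big_mkord.
have le2 : (\sum_(k < m) (e1 / 2 ^+ k.+1)%:E <= e1%:E)%E.
  rewrite sumEFin lee_fin.
  have -> : \sum_(k < m) e1 / 2 ^+ k.+1 = e1 * (1 - (2 ^+ m)^-1).
    elim: m {Dm le1} => [|m IH]; first by rewrite big_ord0 expr0 invr1 subrr
      mulr0.
    by rewrite big_ord_recr/= IH exprS; field; rewrite expf_neq0.
  by rewrite ler_piMr ?(ltW e10)// lerBlDr lerDl invr_ge0 exprn_ge0.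
apply: (@le_trans _ _ ((2 `^ beta)%:E * (e1%:E + e1%:E))%E).
  by rewrite lee_wpmul2l ?lee_fin ?powR_ge0// leeD.
rewrite -EFinD -EFinM lee_fin /e1 le_eqVlt; apply/orP; left; apply/eqP.
by field; rewrite gt_eqF// powR_gt0.
Qed.

Lemma covering_numberP (R : realType) (d : nat) (delta : R) (A : set 'rV[R]_d) :
  (covering_number delta A < +oo)%E ->
  exists k : nat, covering_number delta A = (k%:R)%:E /\
    exists U : 'I_k -> set 'rV[R]_d,
      A `<=` \bigcup_i U i /\ forall i, (diam (U i) <= delta%:E)%E.
Proof.
move=> /ereal_inf_lt[_ [k kS _] _].
pose S (k : nat) := `[< exists U : 'I_k -> set 'rV[R]_d,
      A `<=` \bigcup_i U i /\ forall i, (diam (U i) <= delta%:E)%E >].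
have exS : exists k, S k by exists k; apply/asboolP.
have [m /asboolP mS mmin] := ex_minnP exS.
exists m; split => //; apply/eqP; rewrite eq_le; apply/andP; split.
  by apply: ereal_inf_lbound; exists m.
apply: le_ereal_inf_tmp => _ [l lS <-]; rewrite lee_fin ler_nat; apply: mmin.
exact/asboolP.
Qed.

Lemma upper_box_dim_cover (R : realType) (d : nat) (A : set 'rV[R]_d) (s eps :
  R) :
  (upper_box_dim A <= s%:E)%E -> 0 < eps -> A !=set0 ->
  exists j0 : nat, forall j, (j0 <= j)%N ->
  exists (N : nat) (U : 'I_N -> set 'rV[R]_d),
    [/\ (0 < N)%N, A `<=` \bigcup_i U i,
        forall i, (diam (U i) <= ((2 ^ j)%:R^-1)%:E)%E &
        N%:R <= (2 ^ j)%:R `^ (s + eps) :> R].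
Proof.
move=> dimA eps0 [a Aa].
have : (upper_box_dim A < (s + eps)%:E)%E.
  by apply: le_lt_trans dimA _; rewrite lte_fin ltrDl.
move=> /ereal_inf_lt[_ [V V0 <-] supV].
have [r r0 Vr] : exists2 r : R, 0 < r & forall x : R, 0 < x < r -> V x.
  move: V0; rewrite /= /at_right /within/= => -[r /= r0 Hr];
    exists r => // x /andP[x0 xr].
  by apply: Hr => //=; rewrite sub0r normrN gtr0_norm.
(* Then [2 ^ j > j > 1 / r], and [j > 0] makes the logarithm of [2 ^ j] positive. *)
exists (Num.truncn r^-1).+1 => j jr.
have j0 : (0 < j)%N by apply: leq_ltn_trans jr.
have M0 : 0 < (2 ^ j)%:R :> R by rewrite ltr0n expn_gt0.
have M1 : 1 < (2 ^ j)%:R :> R by rewrite ltr1n -{1}(expn0 2) ltn_exp2l.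
have Mr : (0 : R) < ((2 ^ j)%:R^-1 : R) < r.
  rewrite invr_gt0 M0/= -[r]invrK ltf_pV2 ?posrE ?invr_gt0//.
  apply: lt_le_trans (truncnS_gt _) _; rewrite ler_nat.
  by apply: leq_trans jr _; apply/ltnW/ltn_expl.
have lnM : 0 < ln ((2 ^ j)%:R : R) by rewrite ln_gt0.
have : (lne (covering_number ((2 ^ j)%:R^-1) A) * ((- ln ((2 ^ j)%:R^-1 :
  R))^-1)%:E <
    (s + eps)%:E)%E.
  by apply: le_lt_trans supV; apply: ereal_sup_ubound;
    exists (2 ^ j)%:R^-1 => //; exact: Vr.
rewrite lnV ?posrE// opprK.
have [/eqP->|] := boolP (covering_number ((2 ^ j)%:R^-1) A == +oo%E).
  by rewrite /= mulyr gtr0_sg ?invr_gt0// mul1e.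
rewrite -ltey => /covering_numberP[N [-> [U [AU dU]]]].
(* A point of [A] forces [N] to be positive, so that [lne] is a real logarithm and not [-oo]. *)
have N0 : (0 < N)%N by have [[i iN] _ _] := AU _ Aa; apply: leq_ltn_trans iN.
have N0r : 0 < N%:R :> R by rewrite ltr0n.
rewrite lne_EFin//.
rewrite -EFinM lte_fin ltr_pdivrMr// => lnN.
exists N, U; split => //; rewrite /powR gt_eqF//.
by rewrite -[leLHS]lnK ?posrE// ler_expR ltW.
Qed.

(** * Pigeonholing a scale *)

Lemma itv_cover_length (R : realType) (T : eqType) (s : seq T) (t r : T -> R)
    (a b : R) : a <= b -> (forall i, 0 <= r i) ->
  (forall x, a <= x <= b -> exists2 i, i \in s & `|x - t i| <= r i) ->
  b - a <= \sum_(i <- s) 2 * r i.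
Proof.
move=> ab r0 cov.
have len (u v : R) : u <= v ->
    (\int[lebesgue_measure]_x (\1_`[u, v] x)%:E = (v - u)%:E :> \bar R)%E.
  move=> uv; rewrite integral_indic// setIT.
  have := @lebesgue_measure_itv R `[u, v]; rewrite /= lte_fin => ->.
  case: ltP => [_|vu]; first by rewrite EFinB.
  by rewrite (_ : u = v) ?subrr//; apply/eqP; rewrite eq_le uv.
have -> : \sum_(i <- s) 2 * r i = \sum_(i <- s) ((t i + r i) - (t i - r i)).
  by apply: eq_bigr => i _; ring.
rewrite -lee_fin -len// -sumEFin.
have mi (u v : R) : measurable_fun setT (fun x : R => (\1_`[u, v] x)%:E :
  \bar R).
  by apply/measurable_EFinP; apply: measurable_indic.
rewrite [leRHS](_ : _ = (\int[lebesgue_measure]_x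
    \sum_(i <- s) (\1_`[t i - r i, t i + r i] x)%:E)%E); last first.
  rewrite ge0_integral_sum//; last by move=> i; exact: mi.
  by apply: eq_bigr => i _; rewrite len//; have := r0 i; lra.
apply: ge0_le_integral_nomeas => x _; first by rewrite lee_fin.
rewrite sumEFin lee_fin indicE; case: (boolP (x \in _)) => [/set_mem|_];
  last first.
  by apply: sumr_ge0 => i _.
rewrite /= in_itv/= => /cov[i iS xi].
rewrite (big_rem i)//= indicE mem_set/=; last by rewrite in_itv/= -ler_distl.
by rewrite lerDl; apply: sumr_ge0 => k _.
Qed.

(** The weights [(1 - theta) * theta ^+ j] sum to less than 1 for every [n], so the loss depends on
    the chosen [j] but not on the number of scales. *)
Lemma geometric_pigeonhole (R : realType) (n : nat) (x : 'I_n -> R) (X theta :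
  R) :
  0 < X -> 0 < theta < 1 -> X <= \sum_(j < n) x j ->
  exists j : 'I_n, X * (1 - theta) * theta ^+ j <= x j.
Proof.
move=> X0 /andP[t0 t1] Xx; apply: contrapT => /forallNP H.
have geo m : \sum_(j < m) X * (1 - theta) * theta ^+ j = X * (1 - theta ^+ m).
  elim: m => [|m IH]; first by rewrite big_ord0 expr0 subrr mulr0.
  by rewrite big_ord_recr/= IH exprS; ring.
have : \sum_(j < n) x j <= \sum_(j < n) X * (1 - theta) * theta ^+ j.
  by apply: ler_sum => j _; have /negP := H j; rewrite -ltNge => /ltW.
have tn : 0 < theta ^+ n by rewrite exprn_gt0.
rewrite geo; nra.
Qed.

Section scales.
Context {R : realType} {d : nat}.
Local Notation dir j := {ffun 'I_d.+1 -> 'I_(2 ^ j)}.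
Local Notation cell := {ffun 'I_d.+2 -> int}.

Definition slope_dir (J : nat) (v : dir J) : 'rV[R]_d.+2 :=
  cons_rV (1, \row_k ((v k)%:R / (2 ^ J)%:R)).

Definition meets_fat_cell (lam : R) (a : 'rV[R]_d.+2) (J : nat) (v : dir J)
    (j : nat) (c : cell) : Prop :=
  exists2 s : R, lam <= s <= 2 * lam & fat_cell j c (a + s *: slope_dir J v).

Definition scale_cells (F : seq (nat * cell)) (j : nat) : seq cell :=
  [seq jc.2 | jc <- F & jc.1 == j].

Lemma uniq_scale_cells F j : uniq F -> uniq (scale_cells F j).
Proof.
move=> uF; rewrite map_inj_in_uniq ?filter_uniq// => -[j1 c1] [j2 c2].
by rewrite !mem_filter /= => /andP[/eqP -> _] /andP[/eqP -> _] ->.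
Qed.

Lemma line_coord (n : nat) (a e : 'rV[R]_n) (s : R) k :
  (a + s *: e) ord0 k = a ord0 k + s * e ord0 k.
Proof. by rewrite !mxE. Qed.

(** On first coordinates a fat cell of scale [j] becomes an interval of length [4 / 2 ^ j]. The
    intervals of the cells met by the segment cover a length [lam], and this length is distributed
    over the scales. *)
Lemma scale_pigeonhole (F : seq (nat * cell)) (J : nat) (v : dir J)
    (a : 'rV[R]_d.+2) (lam theta : R) :
  0 < lam -> 0 < theta < 1 -> (forall jc, jc \in F -> (jc.1 <= J)%N) ->
  (forall s, lam <= s <= 2 * lam ->
    exists2 jc, jc \in F & fat_cell jc.1 jc.2 (a + s *: slope_dir J v)) ->
  exists j : 'I_J.+1, lam * (1 - theta) * theta ^+ j * (2 ^ j)%:R / 4 <=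
    (count (fun c => `[< meets_fat_cell lam a J v j c >]) (scale_cells F j))%:R.
Proof.
move=> lam0 theta01 FJ cov.
have M0 j : 0 < (2 ^ j)%:R :> R by rewrite ltr0n expn_gt0.
pose near (jc : nat * cell) := `[< meets_fat_cell lam a J v jc.1 jc.2 >].
pose cnt (j : 'I_J.+1) : R :=
  (count (fun c => `[< meets_fat_cell lam a J v j c >]) (scale_cells F j))%:R.
have : lam <= \sum_(jc <- [seq jc <- F | near jc]) 2 * (2 / (2 ^ jc.1)%:R).
  rewrite -{1}(_ : 2 * lam - lam = lam); last by ring.
  apply: (itv_cover_length _ _ _
    (fun jc : nat * cell => (jc.2 ord0)%:~R / (2 ^ jc.1)%:R - a ord0 ord0)
    (fun jc => 2 / (2 ^ jc.1)%:R)); first by lra.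
    by move=> jc; rewrite divr_ge0 ?(ltW (M0 _)).
  move=> x xI; have [jc jcF jcx] := cov x xI; exists jc.
    by rewrite mem_filter jcF andbT; apply/asboolP; exists x.
  have := jcx ord0; rewrite line_coord cons_rV0E mulr1 => h.
  rewrite ler_pdivlMr// mulrC -{1}(gtr0_norm (M0 jc.1)) -normrM.
  rewrite (_ : _ * (x - _) = (2 ^ jc.1)%:R * (a ord0 ord0 + x) - (jc.2
    ord0)%:~R).
    exact: ltW.
  by field; rewrite gt_eqF.
have -> : \sum_(jc <- [seq jc <- F | near jc]) 2 * (2 / (2 ^ jc.1)%:R) =
    \sum_(j < J.+1) (4 / (2 ^ j)%:R) * cnt j.
  rewrite big_filter (partition_big (fun jc => inord jc.1 : 'I_J.+1) xpredT)//=.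
  apply: eq_bigr => j _; rewrite /cnt /scale_cells count_map -sum1_count
    big_filter_cond.
  rewrite natr_sum mulr_sumr big_seq_cond [RHS]big_seq_cond.
  apply: eq_big => [jc|jc /andP[jcF /andP[_ /eqP <-]]].
    case: (boolP (jc \in F)) => //= jcF; rewrite andbC /near.
    have -> : (inord jc.1 == j) = (jc.1 == j :> nat) by rewrite -val_eqE/=
      inordK// ltnS FJ.
    by case: eqP => //= ->.
  by rewrite mulr1 inordK ?ltnS ?FJ//; ring.
move=> /(geometric_pigeonhole _ _ _ _ _ lam0 theta01) [j hj]; exists j.
rewrite -/(cnt j) ler_pdivrMr//; move: hj.
rewrite [4 / _ * _]mulrAC ler_pdivlMr// => /le_trans; apply; lra.
Qed.

End scales.

Section coarsen.
Context {d J j : nat}.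
Hypothesis jJ : (j <= J)%N.
Local Notation dir j := {ffun 'I_d.+1 -> 'I_(2 ^ j)}.

Let coarsen_subproof (i : 'I_(2 ^ J)) : (i %/ 2 ^ (J - j) < 2 ^ j)%N.
Proof. by rewrite ltn_divLR ?expn_gt0// -expnD subnKC. Qed.

Definition coarsen (v : dir J) : dir j := [ffun k => Ordinal (coarsen_subproof
  (v k))].

Lemma card_coarsen (E : {set dir J}) :
  (#|E| <= #|[set coarsen v | v in E]%SET| * (2 ^ (J - j)) ^ d.+1)%N.
Proof.
have m0 : (0 < 2 ^ (J - j))%N by rewrite expn_gt0.
pose G (v : dir J) : dir j * {ffun 'I_d.+1 -> 'I_(2 ^ (J - j))} :=
  (coarsen v, [ffun k => Ordinal (ltn_pmod (v k) m0)]).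
have Ginj : injective G.
  move=> v v' [] /ffunP Ev /ffunP Em; apply/ffunP => k; apply: val_inj => /=.
  move: (Ev k) (Em k); rewrite !ffunE => /(congr1 val)/= e1 /(congr1 val)/= e2.
  by rewrite (divn_eq (v k) (2 ^ (J - j))) e1 e2 -divn_eq.
rewrite -(card_imset (mem E) Ginj).
have -> : ((2 ^ (J - j)) ^ d.+1 = #|[set: {ffun 'I_d.+1 -> 'I_(2 ^ (J -
  j))}]%SET|)%N.
  by rewrite cardsT card_ffun !card_ord.
rewrite -cardsX; apply/subset_leq_card/fintype.subsetP => _ /imsetP[v vE ->].
by rewrite !inE/= andbT; apply/imsetP; exists v.
Qed.

End coarsen.

(** The good scale of a direction is not known in advance, so directions start at the finest scale
    [J]. Each selects its scale, a popular [j] is kept, and its directions are rounded to [2 ^ j]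
    values per entry. The map [w] remembers a fine direction above each coarse one, since it is the
    fine segment that meets the cells. *)
Lemma multiscale_pigeonhole (R : realType) (d : nat)
    (F : seq (nat * {ffun 'I_d.+2 -> int})) (J : nat)
    (a : {ffun 'I_d.+1 -> 'I_(2 ^ J)} -> 'rV[R]_d.+2) (lam theta : R) :
  0 < lam -> 0 < theta < 1 -> (forall jc, jc \in F -> (jc.1 <= J)%N) ->
  (forall v s, lam <= s <= 2 * lam ->
    exists2 jc, jc \in F & fat_cell jc.1 jc.2 (a v + s *: slope_dir J v)) ->
  exists (j : nat) (jJ : (j <= J)%N) (D : {set {ffun 'I_d.+1 -> 'I_(2 ^ j)}})
    (w : {ffun 'I_d.+1 -> 'I_(2 ^ j)} -> {ffun 'I_d.+1 -> 'I_(2 ^ J)}),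
  [/\ forall q, q \in D -> coarsen jJ (w q) = q,
    (1 - theta) * theta ^+ j * (2 ^ j)%:R ^+ d.+1 <= #|D|%:R &
    forall q, q \in D -> lam * (1 - theta) * theta ^+ j * (2 ^ j)%:R / 4 <=
    (count (fun c => `[< meets_fat_cell lam (a (w q)) J (w q) j c >])
      (scale_cells F j))%:R].
Proof.
move=> lam0 theta01 FJ cov.
pose dJ := {ffun 'I_d.+1 -> 'I_(2 ^ J)}.
have scale (v : dJ) := scale_pigeonhole F J v (a v) lam theta lam0 theta01 FJ
  (cov v).
pose sc (v : dJ) : 'I_J.+1 := projT1 (cid (scale v)).
have scP (v : dJ) : lam * (1 - theta) * theta ^+ sc v * (2 ^ sc v)%:R / 4 <=
    (count (fun c => `[< meets_fat_cell lam (a v) J v (sc v) c >]) (scale_cells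
      F (sc v)))%:R.
  by rewrite /sc; case: (cid _).
pose E (j : 'I_J.+1) : {set dJ} := [set v : dJ | sc v == j]%SET.
pose V : R := #|{: dJ}|%:R.
have VE : V = (2 ^ J)%:R ^+ d.+1 by rewrite /V card_ffun !card_ord natrX.
have V0 : 0 < V by rewrite VE exprn_gt0// ltr0n expn_gt0.
have [j Ej] : exists j : 'I_J.+1, V * (1 - theta) * theta ^+ j <= #|E j|%:R.
  apply: geometric_pigeonhole => //.
  rewrite -natr_sum ler_nat -sum1_card (partition_big sc xpredT)//=.
  apply: leq_sum => j _; rewrite sum1_card;
    apply/subset_leq_card/fintype.subsetP => v.
  by rewrite inE.
have jJ : (j <= J)%N by rewrite -ltnS.
pose D := [set coarsen jJ v | v in E j]%SET.
have v0 : dJ by exact: [ffun => Ordinal (expn_gt0 2 J : (0 < 2 ^ J)%N)].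
have wex q : exists v, q \in D -> v \in E j /\ coarsen jJ v = q.
  by have [/imsetP[v vE ->]|qD] := boolP (q \in D); [exists v|exists v0].
pose w q := projT1 (cid (wex q)).
have wP q : q \in D -> w q \in E j /\ coarsen jJ (w q) = q.
  by rewrite /w; case: (cid _).
exists j, jJ, D, w; split.
- by move=> q /wP[].
- have m0 : 0 < ((2 ^ (J - j)) ^ d.+1)%:R :> R by rewrite ltr0n !expn_gt0.
  rewrite -(ler_pM2r m0) -natrM; apply: (@le_trans _ _ #|E j|%:R); last first.
    by rewrite ler_nat card_coarsen.
  have JE : (2 ^ J)%:R = (2 ^ j)%:R * (2 ^ (J - j))%:R :> R.
    by rewrite -natrM -expnD subnKC.
  apply: le_trans Ej; rewrite VE JE exprMn [((2 ^ (J - j)) ^ _)%:R]natrX.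
  by rewrite le_eqVlt; apply/orP; left; apply/eqP; ring.
- move=> q /wP[]; rewrite inE => /eqP sj _.
  by have := scP (w q); rewrite sj.
Qed.

(** * The lower bound *)

Lemma enormZ (R : realType) (n : nat) (c : R) (x : 'rV[R]_n) :
  enorm (c *: x) = `|c| * enorm x.
Proof.
rewrite /enorm -sqrtr_sqr -sqrtrM ?sqr_ge0//; congr Num.sqrt.
by rewrite mulr_sumr; apply: eq_bigr => i _; rewrite mxE exprMn.
Qed.

(** The vector of slopes has norm at most [d.+2%:R], so parameters up to [2 * (4 * d.+2%:R)^-1] stay
    within distance [1 / 2] of the midpoint [a]. *)
Lemma restricted_kakeya_slope (R : realType) (d : nat) (A K : set 'rV[R]_d.+2)
    (J : nat) (v : {ffun 'I_d.+1 -> 'I_(2 ^ J)}) :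
  restricted_kakeya A K -> exists a, A a /\ forall s,
    (4 * d.+2%:R)^-1 <= s <= 2 * (4 * d.+2%:R)^-1 -> K (a + s *: slope_dir J v).
Proof.
move=> [_ HK]; set lam : R := (4 * d.+2%:R)^-1; set E := slope_dir J v.
have lam0 : 0 < lam by rewrite invr_gt0 mulr_gt0.
have E1 : 1 <= enorm E.
  apply: le_trans (coord_le_enorm E ord0); rewrite /E/slope_dir cons_rV0E
    normr1//.
have En : enorm E <= d.+2%:R * 1.
  apply: enorm_le => i; case: (unliftP ord0 i) => [k|] ->; last first.
    by rewrite /E/slope_dir cons_rV0E normr1.
  rewrite /E/slope_dir cons_rVSE mxE ger0_norm ?divr_ge0//.
  have J0 : 0 < (2 ^ J)%:R :> R by rewrite ltr0n expn_gt0.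
  by rewrite ler_pdivrMr// mul1r ler_nat ltnW.
have E0 : 0 < enorm E by lra.
have [|a Aa aK] := HK ((enorm E)^-1 *: E).
  by rewrite enormZ gtr0_norm ?invr_gt0// mulVf// gt_eqF.
exists a; split => // s /andP[s1 s2]; apply: aK.
exists (s * enorm E); last by rewrite scalerA -mulrA mulfV ?mulr1// gt_eqF.
have sE0 : 0 <= s * enorm E by rewrite mulr_ge0//; lra.
have : s * enorm E <= 2 * lam * (d.+2%:R * 1) by rewrite ler_pM//; lra.
have -> : 2 * lam * (d.+2%:R * 1) = 2^-1.
  have : d.+2%:R != 0 :> R by rewrite pnatr_eq0.
  by rewrite /lam; move: (d.+2%:R) => x x0; field.
by move=> ?; rewrite /= in_itv/=; apply/andP; split => //; lra.
Qed.

(** The constant 4 is 2 for the fat cell, 1 for moving the base point to [b], and 1 for rounding the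
    direction, since [s <= 1]. *)
Lemma near_cell_coarsen (R : realType) (d J j N : nat) (jJ : (j <= J)%N)
    (b : 'I_N -> 'I_d.+2 -> R) (al : {ffun 'I_d.+1 -> 'I_(2 ^ j)} -> 'I_N)
    (lam : R) (a : 'rV[R]_d.+2) (v : {ffun 'I_d.+1 -> 'I_(2 ^ J)})
    (c : {ffun 'I_d.+2 -> int}) : 0 < lam -> 2 * lam <= 1 ->
  (forall i, `|b (al (coarsen jJ v)) i - a ord0 i| <= (2 ^ j)%:R^-1) ->
  meets_fat_cell lam a J v j c -> near_cell b al lam 4 (coarsen jJ v) c.
Proof.
move=> lam0 lam1 ba [s /andP[s1 s2] sc]; exists s.
have M0 : 0 < (2 ^ j)%:R :> R by rewrite ltr0n expn_gt0.
set M : R := (2 ^ j)%:R in M0 ba *.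
have Mba i : `|M * (b (al (coarsen jJ v)) i - a ord0 i)| <= 1.
  by rewrite normrM gtr0_norm// -ler_pdivlMl// mulr1.
split; first by apply/andP; split; lra.
  have := sc ord0; rewrite line_coord cons_rV0E mulr1 -/M => h.
  have -> : M * (b (al (coarsen jJ v)) ord0 + s) - (c ord0)%:~R =
      M * (b (al (coarsen jJ v)) ord0 - a ord0 ord0) +
      (M * (a ord0 ord0 + s) - (c ord0)%:~R) by ring.
  by apply: le_trans (ler_normD _ _) _; have := Mba ord0; lra.
move=> k; have := sc (lift ord0 k); rewrite line_coord cons_rVSE mxE -/M => h.
set q : R := (coarsen jJ v k)%:R.
have qv : `|q - M * ((v k)%:R / (2 ^ J)%:R)| <= 1.
  have ME : M * ((v k)%:R / (2 ^ J)%:R) = (v k)%:R / (2 ^ (J - j))%:R.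
    have -> : (2 ^ J)%:R = M * (2 ^ (J - j))%:R :> R by rewrite -natrM -expnD
      subnKC.
    by field; rewrite !gt_eqF// ltr0n expn_gt0.
  have m0 : 0 < (2 ^ (J - j))%:R :> R by rewrite ltr0n expn_gt0.
  rewrite ME distrC ler_norml; apply/andP; split.
    have : q * (2 ^ (J - j))%:R <= (v k)%:R.
      by rewrite /q ffunE/= -natrM ler_nat leq_trunc_div.
    by rewrite -ler_pdivlMr// => ?; lra.
  have : (v k)%:R <= (q + 1) * (2 ^ (J - j))%:R.
    rewrite /q ffunE/= natr1 -natrM ler_nat mulSn.
    by rewrite {1}(divn_eq (v k) (2 ^ (J - j))) addnC leq_add2r ltnW//
      ltn_pmod// expn_gt0.
  by rewrite -ler_pdivrMr// => ?; lra.
have -> : M * b (al (coarsen jJ v)) (lift ord0 k) + s * q - (c (lift ord0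
  k))%:~R =
    M * (b (al (coarsen jJ v)) (lift ord0 k) - a ord0 (lift ord0 k)) +
    (M * (a ord0 (lift ord0 k) + s * ((v k)%:R / (2 ^ J)%:R)) - (c (lift ord0
      k))%:~R) +
    s * (q - M * ((v k)%:R / (2 ^ J)%:R)) by ring.
apply: le_trans (ler_normD _ _) _.
have : `|s * (q - M * ((v k)%:R / (2 ^ J)%:R))| <= 1 * 1.
  by rewrite normrM ler_pM// ger0_norm; lra.
move=> ?; apply: le_trans (lerD (ler_normD _ _) (lexx _)) _.
have := Mba (lift ord0 k); lra.
Qed.

(** Absorbs the number of dyadic distances into [M ^ eps], by [1 + x <= exp x]. *)
Lemma succ_le_pow2_powR (R : realType) (eps : R) (j : nat) : 0 < eps ->
  j.+1%:R <= (1 + (eps * ln 2)^-1) * (2 ^ j)%:R `^ eps.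
Proof.
move=> eps0; have ln20 : 0 < ln (2 : R) by rewrite ln_gt0// ltr1n.
set u := eps * ln 2; have u0 : 0 < u by rewrite mulr_gt0.
have P : 1 + j%:R * u <= (2 ^ j)%:R `^ eps.
  rewrite /powR gt_eqF ?ltr0n ?expn_gt0// natrX lnXn// -[ln 2 *+ j]mulr_natl.
  apply: le_trans (expR_ge1Dx _); rewrite lerD2l /u.
  by rewrite mulrCA.
apply: (@le_trans _ _ ((1 + u^-1) * (1 + j%:R * u))); last first.
  by rewrite ler_pM2l// addr_gt0 ?invr_gt0.
rewrite -natr1 mulrDl mul1r mulrDr mulr1 [u^-1 * (_ * _)]mulrCA mulVf ?gt_eqF//
  mulr1.
have : 0 <= j%:R * u by rewrite mulr_ge0// ltW.
have : 0 < u^-1 by rewrite invr_gt0.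
lra.
Qed.

(* The comparison of exponents that contradicts a cover by [B <= eta M ^ beta]
   cells of side [1 / M]. *)
Lemma exponent_contradiction (R : realType) (d j : nat)
    (h p s beta eps lam th C eta N B nD nu : R) :
  0 < eps -> 0 < h -> 1 < p -> 0 <= s ->
  beta + 8 * eps = d.+2%:R - (h + s * (1 - p^-1)) ->
  0 < lam -> 0 < th < 1 -> 0 < C -> 0 <= N -> 0 <= B ->
  let M := (2 ^ j)%:R in
  let c0 := ((1 - th) * (lam * (1 - th) / 4)) ^+ 2 in
  eta = c0 / (2 * (C * (1 + (eps * ln 2)^-1))) ->
  (1 - th) * M `^ (- eps) * M ^+ d.+1 <= nD ->
  nu = lam * (1 - th) * M `^ (- eps) * M / 4 ->
  B <= eta * M `^ beta -> N <= M `^ (s + eps) ->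
  (nD * nu) ^+ 2 <= B * (C * j.+1%:R * M ^+ d.+2 * M `^ (h + eps) * N `^ (1 -
    p^-1)) ->
  False.
Proof.
move=> eps0 h0 p1 s0 betaE lam0 /andP[th0 th1] C0 N0 B0 M c0 etaE nDle nuE Ble
  Nle.
have M1 : 1 <= M by rewrite ler1n expn_gt0.
have M0 : 0 < M by lra.
have Mn (k : nat) : M ^+ k = M `^ k%:R by rewrite powR_mulrn// ltW.
have MD (x y : R) : M `^ x * M `^ y = M `^ (x + y).
  by rewrite powRD// (gt_eqF M0) implybT.
have pV0 : 0 < p^-1 by rewrite invr_gt0; lra.
have pV1 : p^-1 < 1 by rewrite invf_lt1//; lra.
have ln20 : 0 < ln (2 : R) by rewrite ln_gt0// ltr1n.
have c00 : 0 < c0.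
  by rewrite exprn_gt0// !mulr_gt0 ?divr_gt0 ?subr_gt0.
set k := 1 + (eps * ln 2)^-1 in etaE.
have k0 : 0 < k by rewrite addr_gt0 ?invr_gt0 ?mulr_gt0.
have eta0 : 0 < eta by rewrite etaE divr_gt0 // !mulr_gt0.
have nu0 : 0 <= nu.
  by apply: ltW; rewrite nuE divr_gt0 // !mulr_gt0 ?powR_gt0 ?subr_gt0.
(* The pigeonhole loses [M ^ eps] in the number of directions and again in the number of cells, and
   the product is squared. *)
set L := 2 * d.+2%:R - 4 * eps.
have low : c0 * M `^ L <= (nD * nu) ^+ 2.
  have -> : c0 * M `^ L =
      ((1 - th) * M `^ (- eps) * M ^+ d.+1 * nu) ^+ 2.
    have -> : M `^ L = (M `^ (- eps) * M `^ (- eps) * M ^+ d.+1 * M) ^+ 2.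
      rewrite -[_ * _ * M]mulrA -exprSr Mn !MD expr2 MD; congr (M `^ _).
      by rewrite /L; ring.
    by rewrite /c0 nuE; field.
  rewrite lerXn2r ?nnegrE ?mulr_ge0 ?powR_ge0 ?exprn_ge0 ?(ltW M0)//; try lra.
    by apply: le_trans nDle; rewrite !mulr_ge0 ?powR_ge0 ?exprn_ge0 ?(ltW M0)//;
      lra.
  by rewrite ler_wpM2r.
have Npow : N `^ (1 - p^-1) <= M `^ ((s + eps) * (1 - p^-1)).
  by rewrite powRrM ge0_ler_powR ?nnegrE ?powR_ge0//; lra.
have jle := succ_le_pow2_powR _ _ j eps0.
rewrite -/k -/M in jle.
have X0 : 0 <= C * j.+1%:R * M ^+ d.+2 * M `^ (h + eps).
  apply: mulr_ge0 (powR_ge0 _ _); apply: mulr_ge0 (exprn_ge0 _ (ltW M0)).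
  by rewrite mulr_ge0// ltW.
move=> up; have := le_trans low up; apply/negP; rewrite -ltNge.
apply: (@le_lt_trans _ _ ((eta * M `^ beta) *
    (C * (k * M `^ eps) * M ^+ d.+2 * M `^ (h + eps) * M `^ ((s + eps) * (1 -
      p^-1))))).
  rewrite ler_pM//.
    exact: mulr_ge0 X0 (powR_ge0 _ _).
  apply: ler_pM => //; first exact: powR_ge0.
  rewrite ler_wpM2r ?powR_ge0// ler_wpM2r ?exprn_ge0 ?(ltW M0)//.
  by rewrite ler_wpM2l// ltW.
(* By the choice of [beta], [E = 2 * d.+2%:R - 8 * eps + (3 - p^-1) * eps], which is below [L]. *)
set E := beta + eps + d.+2%:R + (h + eps) + (s + eps) * (1 - p^-1).
have -> : eta * M `^ beta * (C * (k * M `^ eps) * M ^+ d.+2 * M `^ (h + eps) *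
    M `^ ((s + eps) * (1 - p^-1))) = c0 / 2 * M `^ E.
  have -> : M `^ E = M `^ beta * M `^ eps * M ^+ d.+2 * M `^ (h + eps) *
      M `^ ((s + eps) * (1 - p^-1)) by rewrite Mn !MD.
  by rewrite etaE; field; rewrite !gt_eqF.
apply: (@le_lt_trans _ _ (c0 / 2 * M `^ L)).
  rewrite ler_wpM2l ?divr_ge0 ?(ltW c00)// ler_powR//.
  rewrite /E /L; nra.
(* Strictness comes from the factor 2 in the denominator of [eta], not from the powers, as [M] may
   be 1. *)
rewrite ltr_pM2r ?powR_gt0//; lra.
Qed.

Lemma size_scale_cells_le (R : realType) (d j : nat) (beta eta : R)
    (F : seq (nat * {ffun 'I_d.+2 -> int})) :
  \sum_(jc <- F) (2 ^ jc.1)%:R^-1 `^ beta <= eta ->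
  (size (scale_cells F j))%:R <= eta * (2 ^ j)%:R `^ beta.
Proof.
move=> Feta; have M0 : 0 < (2 ^ j)%:R :> R by rewrite ltr0n expn_gt0.
rewrite -ler_pdivrMr ?powR_gt0//; apply: le_trans Feta.
rewrite /scale_cells size_map size_filter.
apply: (@le_trans _ _ (\sum_(jc <- F | jc.1 == j) (2 ^ jc.1)%:R^-1 `^ beta)).
  rewrite (eq_bigr (fun=> (2 ^ j)%:R^-1 `^ beta)); last by move=> jc /eqP ->.
  rewrite big_const_seq iter_addr_0 -[leRHS]mulr_natl.
  by rewrite -[X in _ <= _ * X `^ _]powR_inv1 ?(ltW M0)// powRAC powR_inv1
    ?powR_ge0.
by rewrite big_mkcond/=; apply: ler_sum => jc _; case: ifP => // _; exact:
  powR_ge0.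
Qed.

Theorem corollary2p7 (R : realType) (n : nat) (n_ge3 : (3 <= n)%N)
    (h p : R) (h_gt0 : 0 < h) (p_gt1 : 1 < p)
    (maximal_bound : kakeya_maximal_bound n.-1 h p)
    (s : R) (s_itv : 0 <= s <= n%:R)
    (A K : set 'rV[R]_n) (A_bounded : bounded_set A)
    (dimA : (upper_box_dim A <= s%:E)%E)
    (K_kakeya : restricted_kakeya A K) :
  ((n%:R - g_exponent h p s)%:E <= hausdorff_dim K)%E.
Proof.
case: n n_ge3 maximal_bound s_itv A K A_bounded dimA K_kakeya => [//|[//|d]] _.
move=> maximal_bound /andP[s0 _] A K _ dimA K_kakeya.
rewrite leNgt; apply/negP => /ereal_inf_lt[_ [s1 [s10 HK] <-]].
have -> : g_exponent h p s = h + s * (1 - p^-1).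
  by rewrite /g_exponent; field; lra.
rewrite lte_fin => s1lt.
pose gam : R := d.+2%:R - (h + s * (1 - p^-1)).
(* [beta] is the midpoint of [s1] and the bound [gam]: above [s1], hence positive, and below [gam]
   by [8 * eps], which pays for all the losses. *)
pose beta := (s1 + gam) / 2; pose eps := (gam - beta) / 8.
have s1g : s1 < gam by [].
have eps0 : 0 < eps by rewrite /eps /beta; lra.
have beta0 : 0 < beta by rewrite /beta; lra.
have s1b : 0 <= s1 <= beta by rewrite s10 /beta; lra.
have betaE : beta + 8 * eps = gam by rewrite /eps; field.
pose lam : R := (4 * d.+2%:R)^-1.
have lam0 : 0 < lam by rewrite invr_gt0 mulr_gt0.
have lam1 : 2 * lam <= 1.
  have d1 : 1 <= d.+2%:R :> R by rewrite ler1n.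
  have : lam * (4 * d.+2%:R) = 1 by rewrite mulVf// mulf_neq0 ?pnatr_eq0.
  nra.
have four1 : 1 <= 4 :> R by lra.
have [C C0 incid] := incidence_bound _ _ _ _ _ _ _ maximal_bound h_gt0 p_gt1
  lam0 four1 eps0.
(* With this ratio the pigeonhole loss [th ^+ j] is exactly [M ^ (- eps)]. *)
pose th : R := 2 `^ (- eps).
have ln20 : 0 < ln (2 : R) by rewrite ln_gt0// ltr1n.
have th01 : 0 < th < 1.
  by rewrite /th /powR gt_eqF// expR_gt0 expR_lt1 mulNr oppr_lt0 mulr_gt0.
have thE j : th ^+ j = (2 ^ j)%:R `^ (- eps).
  rewrite /th -powR_mulrn ?powR_ge0// -powRrM natrX -[2 ^+ j]powR_mulrn//
    -powRrM.
  by rewrite [- eps * _]mulrC.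
have slope J v := restricted_kakeya_slope R d A K J v K_kakeya.
have A0 : A !=set0.
  have [a [Aa _]] := slope 0%N [ffun=> ord0]; by exists a.
(* [j0] is fixed before the cover of [K], so that the box-counting bound holds at whichever scale
   the pigeonhole selects. *)
have [j0 boxA] := upper_box_dim_cover _ _ _ _ _ dimA eps0 A0.
pose c0 : R := ((1 - th) * (lam * (1 - th) / 4)) ^+ 2.
pose eta := c0 / (2 * (C * (1 + (eps * ln 2)^-1))).
have eta0 : 0 < eta.
  case/andP: th01 => th0 th1; rewrite divr_gt0//.
    by rewrite exprn_gt0// !mulr_gt0 ?divr_gt0 ?mulr_gt0 ?subr_gt0.
  by rewrite !mulr_gt0// addr_gt0// invr_gt0 mulr_gt0.
have [F [uF Fj0 KF Feta]] := hausdorff_null_cells _ _ _ _ _ _ j0 K_kakeya.1 HK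
  s1b beta0 eta0.
pose J := (\max_(jc <- F) jc.1)%N.
have FJ jc : jc \in F -> (jc.1 <= J)%N.
  by move=> jcF; rewrite (@leq_bigmax_seq _ _ xpredT (fun jc => jc.1)).
pose a v := projT1 (cid (slope J v)).
have aP v : A (a v) /\ forall t, lam <= t <= 2 * lam -> K (a v + t *:
  slope_dir J v).
  by rewrite /a; case: (cid _).
have [j [jJ [D [w [wD cardD cntD]]]]] := multiscale_pigeonhole _ _ F J a lam th
  lam0 th01 FJ
  (fun v t ht => KF _ ((aP v).2 t ht)).
set M : R := (2 ^ j)%:R in cardD cntD.
have M0 : 0 < M by rewrite ltr0n expn_gt0.
have [th0 th1] := andP th01.
pose nu := lam * (1 - th) * th ^+ j * M / 4.
have nu0 : 0 < nu.
  by rewrite divr_gt0// !mulr_gt0 ?exprn_gt0 ?subr_gt0.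
have [q qD] : exists q, q \in D.
  apply/set0Pn; rewrite -card_gt0 -(ltr_nat R); apply: lt_le_trans cardD.
  by rewrite !mulr_gt0 ?exprn_gt0 ?subr_gt0.
(* A direction of [D] meets at least one cell of scale [j], so [j] is a scale of the cover. *)
have jj0 : (j0 <= j)%N.
  have := lt_le_trans nu0 (cntD q qD); rewrite ltr0n -has_count => /hasP[c].
  move=> /mapP[jc]; rewrite mem_filter => /andP[/eqP <- jcF] _ _; exact: Fj0.
have [N [U [N0 AU dU Nle]]] := boxA j jj0.
have clsP v : exists i, U i (a v).
  by have [i _ Ui] := AU _ (aP v).1; exists i.
pose al q' := projT1 (cid (clsP (w q'))).
have alP q' : U (al q') (a (w q')) by rewrite /al; case: (cid _).
(* A representative point for each set of the cover of [A], 0 by default; only the sets that contain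
   a base point matter below. *)
have ptP i : exists x, U i !=set0 -> U i x.
  by have [[x Ux]|nU] := pselect (U i !=set0); [exists x|exists 0].
pose pt i := projT1 (cid (ptP i)).
have ptU i : U i !=set0 -> U i (pt i) by rewrite /pt; case: (cid _).
pose b i k := pt i ord0 k.
have ba q' k : `|b (al q') k - a (w q') ord0 k| <= M^-1.
  have := coord_le_enorm (pt (al q') - a (w q')) k; rewrite !mxE => /le_trans;
    apply.
  rewrite -lee_fin; apply: le_trans (dU (al q')); apply: diam_ge => //.
  by apply: ptU; exists (a (w q')).
have cnt q' : q' \in D -> nu <= (count (fun c => `[< near_cell b al lam 4 q' c
  >])
    (scale_cells F j))%:R.
  move=> q'D; apply: le_trans (cntD q' q'D) _; rewrite ler_nat; apply:
    sub_count => c.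
  move=> /asboolP near; apply/asboolP; rewrite -(wD q' q'D).
  apply: near_cell_coarsen lam0 lam1 _ near => i.
  by rewrite (wD q' q'D); exact: ba.
have up := incid j N b al D _ nu N0 (uniq_scale_cells F j uF) (ltW nu0) cnt.
apply: (exponent_contradiction R d j h p s beta eps lam th C eta N%:R
  (size (scale_cells F j))%:R #|D|%:R nu) => //.
- by rewrite -thE.
- by rewrite -thE.
- exact: size_scale_cells_le.
Qed.
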